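(* Let $s,t\ge0$ and $u\in\mathrm{C}_{\mathrm b}$. Then $$\big(I(t)I(s)u\big)(x)\le\big(I(t+s)u\big)(x)\quad\text{for all }x\in X.$$
   Context: Setting. $(X,\|\cdot\|)$ is a separable Banach space with Borel $\sigma$-algebra $\mathcal B(X)$. $K\colon X\to X$ is a fixed linear operator such that $\{Kx\colon \|x\|\le r\}$ is compact for all $r\ge 0$, $\{Kx\colon x\in X\}$ is dense in $X$, and $\|Kx\|\le\|x\|$ for all $x\in X$. Function spaces. $\mathrm{Lip}$ is the space of all $u\colon X\to\mathbb R$ with $|u(x_1)-u(x_2)|\le L\|K(x_1-x_2)\|$ for all $x_1,x_2\in X$ and some $L\ge 0$. $\mathrm{Lip}_{\mathrm b}$ is the set of $u\in\mathrm{Lip}$ with $\|u\|_\infty:=\sup_{x\in X}|u(x)|<\infty$. For bounded continuous functions $u_n\colon X\to\mathbb R$ and $u\colon X\to\mathbb R$, write $u_n\to u$ if $\sup_n\|u_n\|_\infty<\infty$ and $\lim_{n\to\infty}\sup_{\|x\|\le r}|u(x)-u_n(x)|=0$ for all $r\ge 0$. $\mathrm{C}_{\mathrm b}$ is the space of all $u\colon X\to\mathbb R$ for which there is a sequence $(u_n)\subset\mathrm{Lip}_{\mathrm b}$ with $u_n\to u$. Wasserstein distance. Fix $p\in(1,\infty)$. $\mathcal P_p(X)$ is the set of Borel probability measures on $X$ with finite $p$-th moment, and $\mathcal W_p(\mu,\nu)=\big(\inf_{\pi\in\mathrm{Cpl}(\mu,\nu)}\int_{X\times X}\|y-z\|^p\,\pi(dy,dz)\big)^{1/p}$,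 where $\mathrm{Cpl}(\mu,\nu)$ is the set of couplings of $\mu$ and $\nu$. Reference model. $(\mu_t)_{t\ge0}\subset\mathcal P_p(X)$ and $\psi_t\colon X\to X$, $t\ge 0$, are continuous maps such that for all $s,t\ge0$, $u\in\mathrm{C}_{\mathrm b}$, $x\in X$, $$\int_X u(\psi_{t+s}(x)+y)\,\mu_{t+s}(dy)=\int_X\int_X u\big(\psi_s(\psi_t(x)+y_t)+y_s\big)\,\mu_s(dy_s)\,\mu_t(dy_t).$$ Standing assumptions: (A1) there is a constant $c\ge0$ with $\|\psi_t(x_1)-\psi_t(x_2)\|\le e^{ct}\|x_1-x_2\|$ for all $t\ge0$, $x_1,x_2\in X$ (this $c$ is fixed); (A2) $K\psi_t(x)=\psi_t(Kx)$ for all $t\ge0$, $x\in X$, $\psi_0(x)=x$ for all $x\in X$, and $\lim_{h\downarrow0}\sup_{\|x\|\le r}\|\psi_h(Kx)-Kx\|=0$ for all $r\ge0$; (A3) $\lim_{h\downarrow0}\int_X\|y\|^p\,\mu_h(dy)=0$. Penalisation. $\varphi\colon[0,\infty)\to[0,\infty]$ is convex and lower semicontinuous, $\varphi(0)=0$, $\varphi(v)\ne0$ for some $v>0$, and $v\mapsto\varphi(v^{1/p})$ is convex. Set $\varphi_t(v)=t\varphi(e^{-ct}v/t)$ for $t>0$, $v\ge 0$, and $\varphi_0(v)=\infty$ for $v>0$, $\varphi_0(0)=0$. Operators. $(I(t)u)(x)=\sup_{\nu\in\mathcal P_p(X)}\big(\int_X u(\psi_t(x)+z)\,\nu(dz)-\varphi_t(\mathcal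 W_p(\mu_t,\nu))\big)$ for $t\ge 0$, $u\in\mathrm{C}_{\mathrm b}$, $x\in X$. The composition $I(t)I(s)u$ is $I(t)$ applied to the bounded continuous function $I(s)u$ via the same formula. *)

(* Defs.v *)
From HB Require Import structures.
From mathcomp Require Import all_boot all_order all_algebra.
From mathcomp Require Import all_classical all_reals all_analysis.

Set Implicit Arguments.
Unset Strict Implicit.
Unset Printing Implicit Defensive.

Import Order.TTheory GRing.Theory Num.Theory.
Import numFieldNormedType.Exports.

Local Open Scope classical_set_scope.
Local Open Scope ring_scope.

Section general.
Context {R : realType}.

Definition separable (T : topologicalType) : Prop :=
  exists2 D : set T, countable D & dense D.

(* Convexity on [0, +oo[ of a function with values in [0, +oo]. At the
   endpoints of the segment the convention 0 * +oo = 0 of \bar R is used. *)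
Definition econvex_nneg (f : R -> \bar R) : Prop :=
  forall v w l : R, 0 <= v -> 0 <= w -> 0 <= l <= 1 ->
    (f (l * v + (1 - l) * w)%R <= l%:E * f v + (1 - l)%R%:E * f w)%E.

(* Only the values phi v with 0 <= v are constrained and used. Lower
   semicontinuity is relative to the half-line [0, +oo[. *)
Definition penalisation (p : R) (phi : R -> \bar R) : Prop :=
  [/\ (forall v, 0 <= v -> (0 <= phi v)%E),
      econvex_nneg phi,
      lower_semicontinuous (phi : subspace `[0, +oo[%classic -> \bar R),
      phi 0 = 0%E &
      (exists2 v, 0 < v & phi v <> 0%E) /\
      econvex_nneg (fun v => phi (v `^ p^-1))].

Definition phit (c : R) (phi : R -> \bar R) (t v : R) : \bar R :=
  if t == 0 then (if v == 0 then 0%E else +oo%E)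
  else (t%:E * phi (expR (- (c * t)) * v / t)%R)%E.

End general.

Section spaces.
Context {R : realType} {X : completeNormedModType R}.
Local Open Scope ereal_scope.

Definition supnorm (u : X -> R) : \bar R :=
  ereal_sup [set `|u x|%:E | x in [set: X]].

Definition supnorm_ball (r : R) (u : X -> R) : \bar R :=
  ereal_sup [set `|u x|%:E | x in [set x : X | (`|x| <= r)%R]].

Definition LipK (K : X -> X) : set (X -> R) :=
  [set u | exists2 L : R, (0 <= L)%R &
    forall x1 x2, (`|u x1 - u x2| <= L * `|K (x1 - x2)|)%R].

Definition LipKb (K : X -> X) : set (X -> R) :=
  [set u | LipK K u /\ supnorm u < +oo].

Definition mixed_cvg (u_ : nat -> X -> R) (u : X -> R) : Prop :=
  ereal_sup (range (fun n => supnorm (u_ n))) < +oo /\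
  forall r : R, (0 <= r)%R ->
    (fun n => supnorm_ball r (fun x => u x - u_ n x)%R) @ \oo --> 0.

(* For K bounded, mixed limits of sequences in LipKb are automatically bounded
   and continuous, so this need not be required of u. *)
Definition Cb (K : X -> X) : set (X -> R) :=
  [set u | exists2 u_ : nat -> X -> R,
    (forall n, LipKb K (u_ n)) & mixed_cvg u_ u].

End spaces.

Definition borel {R : realType} (X : completeNormedModType R) :=
  g_sigma_algebraType (@open X).

Section wasserstein.
Context {R : realType} {X : completeNormedModType R}.
Local Open Scope ereal_scope.

Definition moment (p : R) (nu : probability (borel X) R) : \bar R :=
  \int[nu]_y (`|y : X| `^ p)%:E.

Definition Pp (p : R) : set (probability (borel X) R) :=
  [set nu | moment p nu < +oo].

(* For separable X, the product sigma-algebra carried by borel X * borel X is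
   the Borel sigma-algebra of X * X. *)
Definition Cpl (mu nu : probability (borel X) R) :
    set (probability (borel X * borel X)%type R) :=
  [set pi | forall A : set (borel X), measurable A ->
     pushforward pi fst A = mu A /\ pushforward pi snd A = nu A].

Definition Wp (p : R) (mu nu : probability (borel X) R) : \bar R :=
  (ereal_inf [set \int[pi]_yz (`|(yz.1 : X) - (yz.2 : X)| `^ p)%:E
             | pi in Cpl mu nu]) `^ p^-1.

(* The argument and the value are \bar R-valued functions, so that the operator
   can be iterated without truncation; for u in Cb it is applied to EFin \o u
   and takes finite values. Wp is finite on Pp p, so fine is harmless there. *)
Definition penop (p c : R) (phi : R -> \bar R) (psi : R -> X -> X)
    (mu : R -> probability (borel X) R) (t : R) (u : X -> \bar R) (x : X)
    : \bar R :=
  ereal_sup [set \int[nu]_z u (psi t x + (z : X))%R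
                 - phit c phi t (fine (Wp p (mu t) nu))
            | nu in Pp p].

End wasserstein.

(* Main.v *)
Require Import Defs.
From HB Require Import structures.
From mathcomp Require Import all_boot all_order all_algebra.
From mathcomp Require Import all_classical all_reals all_analysis.
From mathcomp Require Import measurable_realfun giry.
From mathcomp Require Import ring lra.

Import Order.TTheory GRing.Theory Num.Theory.
Import numFieldNormedType.Exports.

Local Open Scope classical_set_scope.
Local Open Scope ring_scope.

(** Two optimisation steps can be pasted into one. Let [x] be the starting point. A
    competitor for the first step is a coupling of [y ~ mu t] with some [z]; for the
    second step, started at [psi t x + z], it is a coupling of [y' ~ mu s] with some
    [z'], chosen according to that point. With [a = psi (t + s) x], consider
      Y = psi s (psi t x + y) + y' - a   and   Z = psi s (psi t x + z) + z' - a.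
    The variable [a + Z] gives [u] the value of the two steps. By the flow identity
    [Y] has, for the functions in [Cb], the same law as [mu (t + s)]. Since
    [`|Y - Z| <= expR (c * s) * `|y - z| + `|y' - z'|], the convexity of
    [v |-> phi (v `^ p^-1)] bounds the penalty of the pair by the sum of the two
    penalties ([Phi_add]), and the same convexity averages the penalty of the second
    step over its starting points ([Phi_jensen]). So [Z] is, up to the correction
    described below, a competitor for time [t + s] that does at least as well; [two_step_bound] carries this out.

    Four difficulties have to be met.

    Optimal couplings would need a compactness argument, and nearly optimal ones may
    have infinite penalty because [phi] may jump to [+oo]. Contracting a nearly optimal
    coupling a little towards its first component makes it as cheap as the infimum
    and hardly changes the integral of a Lipschitz function ([contract_coupling]).

    The second coupling must depend measurably on its starting point. For Lipschitz
    [u] the function [I s u] is Lipschitz ([Ir_lip]), so one coupling for each cell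
    of a fine countable partition is enough ([near_optimal_selection]).

    The operator [K] may have a kernel, and functions in [Cb] only see [K]. The flow
    identity therefore identifies the image under [K] of the law of [Y]
    ([K_law_unique]) but not that law itself. Resampling [Y] from [mu (t + s)] given
    the approximate value of [K Y], with [Z - Y] kept, gives a genuine coupling of
    [mu (t + s)] with the same cost and almost the same value
    ([replace_first_marginal]).

    Finally a general [u] in [Cb] is a mixed limit of bounded Lipschitz functions.
    The operator is continuous along such limits because competitors with moderate
    penalty have uniformly bounded moments ([penop_tight]). *)

(** * Integrals of bounded functions *)
Section bounded.
Context {d} {T : measurableType d} {R : realType}.
Implicit Types (P : probability T R) (f g h : T -> R).

Lemma probability_integral_cst P (k : \bar R) : (\int[P]_x k = k)%E.
Proof. by rewrite integral_cst// [X in (_ * X)%E](probability_setT P) mule1. Qed.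

Definition bmeas f := measurable_fun setT f /\ exists M, forall x, `|f x| <= M.

Lemma bmeas_integrable P f : bmeas f -> P.-integrable setT (EFin \o f).
Proof.
move=> [mf [M fM]].
have := finite_measure_integrable_cst P M measurableT.
apply: le_integrable => //; first exact/measurable_EFinP.
by move=> x _ /=; rewrite lee_fin (le_trans (fM x))// ler_norm.
Qed.

Lemma bmeas_EFin P f : bmeas f ->
  (\int[P]_x (f x)%:E)%E = (\int[P]_x f x)%R%:E.
Proof.
move=> bf; rewrite /Rintegral fineK//.
exact: (integrable_fin_num measurableT (bmeas_integrable P _ bf)).
Qed.

Lemma bmeas_cst (k : R) : bmeas (fun=> k).
Proof. by split=> //; exists `|k|. Qed.

Lemma bmeasD f g : bmeas f -> bmeas g -> bmeas (fun x => f x + g x).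
Proof.
move=> [mf [M fM]] [mg [N gN]]; split; first exact: measurable_funD.
by exists (M + N) => x; rewrite (le_trans (ler_normD _ _))// lerD.
Qed.

Lemma le_Rint P f g : bmeas f -> bmeas g -> (forall x, f x <= g x) ->
  \int[P]_x f x <= \int[P]_x g x.
Proof. by move=> bf bg fg; apply: le_Rintegral => //; exact: bmeas_integrable. Qed.

Lemma Rint_cst P (k : R) : \int[P]_x k = k.
Proof. by rewrite /Rintegral probability_integral_cst. Qed.

Lemma Rint_bound P f M : bmeas f -> (forall x, `|f x| <= M) ->
  `|\int[P]_x f x| <= M.
Proof.
move=> bf fM; rewrite ler_norml -{1}(Rint_cst P (- M)) -{2}(Rint_cst P M).
by apply/andP; split; apply: le_Rint => //; try exact: bmeas_cst;
  move=> x; have := fM x; rewrite ler_norml => /andP[].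
Qed.

Lemma RintD P f g : bmeas f -> bmeas g ->
  \int[P]_x (f x + g x) = \int[P]_x f x + \int[P]_x g x.
Proof. by move=> bf bg; rewrite RintegralD//; exact: bmeas_integrable. Qed.

(** The error splits into a constant and a nonnegative term that is only small in
    mean, such as a power of a distance or the indicator of an unlikely event;
    most comparisons of expectations below have this form. *)
Lemma Rint_le_add P f g h (k H : R) : bmeas f -> bmeas g ->
  measurable_fun setT h -> (forall x, 0 <= h x) ->
  (\int[P]_x (h x)%:E <= H%:E)%E ->
  (forall x, f x <= g x + (k + h x)) ->
  \int[P]_x f x <= \int[P]_x g x + (k + H).
Proof.
move=> bf bg mh h0 hH fg.
have ih : P.-integrable setT (EFin \o h).
  apply/integrableP; split; first exact/measurable_EFinP.
  apply: le_lt_trans (ltry H); rewrite (eq_integral (fun x => (h x)%:E))//.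
  by move=> x _ /=; rewrite ger0_norm.
have ikh : P.-integrable setT (EFin \o (fun x => k + h x)).
  have -> : EFin \o (fun x => k + h x) = (EFin \o cst k) \+ (EFin \o h).
    by apply/funext.
  apply: integrableD => //; exact: (bmeas_integrable P _ (bmeas_cst k)).
have ighk : P.-integrable setT (EFin \o (fun x => g x + (k + h x))).
  have -> : EFin \o (fun x => g x + (k + h x)) =
    (EFin \o g) \+ (EFin \o (fun x => k + h x)) by apply/funext.
  by apply: integrableD => //; exact: bmeas_integrable.
apply: (@le_trans _ _ (\int[P]_x (g x + (k + h x)))).
  by apply: le_Rintegral => //; exact: bmeas_integrable.
rewrite RintegralD//; last exact: bmeas_integrable.
rewrite lerD2l RintegralD//; last exact: (bmeas_integrable P _ (bmeas_cst k)).
rewrite Rint_cst lerD2l -lee_fin /Rintegral fineK//.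
exact: integrable_fin_num.
Qed.

End bounded.

(** * Image laws and mixtures of laws *)
Section bounded_integrals.
Context {d1 d2 d3} {T1 : measurableType d1} {T2 : measurableType d2}
  {T3 : measurableType d3} {R : realType}.

(** Equality of all nonnegative integrals rather than of measures of sets: it is
    the form in which marginals are used. *)
Definition image_law (P : probability T1 R) (f : T1 -> T2) (Q : probability T2 R) :=
  forall g : T2 -> \bar R, measurable_fun setT g -> (forall x, 0 <= g x)%E ->
     (\int[Q]_y g y = \int[P]_x g (f x))%E.

(** [Pi] is the law of [F (w, v)] when [w] has law [P] and [v] is then drawn from
    [Q (n w)]. As the second law depends on [w] through an index in [nat] only,
    measurability in [w] costs nothing. *)
Definition mixture_law (P : probability T1 R) (n : T1 -> nat)
    (Q : nat -> probability T2 R) (F : T1 * T2 -> T3) (Pi : probability T3 R) :=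
  forall g : T3 -> \bar R, measurable_fun setT g -> (forall x, 0 <= g x)%E ->
    measurable_fun setT (fun w => \int[Q (n w)]_v g (F (w, v)))%E /\
    (\int[Pi]_y g y = \int[P]_w \int[Q (n w)]_v g (F (w, v)))%E.

Lemma bmeas_comp d d' (T : measurableType d) (T' : measurableType d')
    (f : T -> T') (g : T' -> R) :
  measurable_fun setT f -> bmeas g -> bmeas (fun x => g (f x)).
Proof.
move=> mf [mg [M gM]]; split; first exact: (measurableT_comp mg mf).
by exists M => x; exact: gM.
Qed.

Lemma bmeas_shift d (T : measurableType d) (P : probability T R) (g : T -> R) (M : R) :
  bmeas g -> (\int[P]_y (g y + M)%:E = (\int[P]_y g y + M)%:E)%E.
Proof.
move=> bg; rewrite bmeas_EFin; last exact: bmeasD bg (bmeas_cst M).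
by rewrite RintD//; [rewrite Rint_cst|exact: bmeas_cst].
Qed.

Lemma image_law_Rint P f Q (g : T2 -> R) : measurable_fun setT f ->
  image_law P f Q -> bmeas g -> \int[Q]_y g y = \int[P]_x g (f x).
Proof.
move=> mf PfQ bg; have [mg [M gM]] := bg.
apply: (addIr M); apply: EFin_inj.
rewrite -bmeas_shift// -[in RHS]bmeas_shift; last exact: bmeas_comp.
apply: (PfQ (fun y => (g y + M)%:E)).
  exact/measurable_EFinP/measurable_funD.
by move=> x; rewrite lee_fin -lerBlDr sub0r; have := gM x; rewrite ler_norml => /andP[].
Qed.

(** Bounded functions are nonnegative up to a constant, and constants integrate to
    themselves under probability measures. *)
Lemma mixture_law_Rint P n Q F Pi (g : T3 -> R) : measurable_fun setT F ->
  mixture_law P n Q F Pi -> bmeas g ->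
  bmeas (fun w => \int[Q (n w)]_v g (F (w, v))) /\
  \int[Pi]_y g y = \int[P]_w \int[Q (n w)]_v g (F (w, v)).
Proof.
move=> mF mix bg; have [mg [M gM]] := bg.
have mFw w : measurable_fun setT (fun v => F (w, v)) by apply: measurableT_comp.
have bgF w : bmeas (fun v => g (F (w, v))) by exact: bmeas_comp.
have [||] := mix (fun y => (g y + M)%:E).
- exact/measurable_EFinP/measurable_funD.
- by move=> x; rewrite lee_fin -lerBlDr sub0r; have := gM x; rewrite ler_norml => /andP[].
under eq_fun do rewrite bmeas_shift//.
move=> /measurable_EFinP mI.
have bI : bmeas (fun w => \int[Q (n w)]_v g (F (w, v))).
  split; last by exists M => w; apply: Rint_bound.
  rewrite [X in measurable_fun _ X](_ : _ = fun w =>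
    \int[Q (n w)]_v g (F (w, v)) + M - M); last by apply/funext => w; rewrite addrK.
  exact: measurable_funB.
rewrite bmeas_shift//.
by rewrite bmeas_shift// => e; split=> //; apply: (addIr M); exact: EFin_inj e.
Qed.

End bounded_integrals.

Section measure_probability.
Context {d} {T : measurableType d} {R : realType}.
Context (m : {measure set T -> \bar R}) (m1 : m setT = 1%E).

(** An alias, so that the total mass can be declared for a measure that already
    carries its own structure. *)
Definition probability_of : set T -> \bar R := m.

HB.instance Definition _ := Measure.on probability_of.
HB.instance Definition _ :=
  Measure_isProbability.Build _ _ _ probability_of m1.

Lemma measure_probability : exists P : probability T R, forall A, P A = m A.
Proof. by exists probability_of. Qed.

End measure_probability.

Section pushforward.
Context {d1 d2} {T1 : measurableType d1} {T2 : measurableType d2} {R : realType}.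

Lemma pushforward_probability (P : probability T1 R) (f : T1 -> T2) :
  measurable_fun setT f ->
  exists Q : probability T2 R, (forall A, Q A = P (f @^-1` A)) /\ image_law P f Q.
Proof.
move=> mf.
have [|Q QE] := @measure_probability _ _ R (giry_map mf P).
  exact: (probability_setT P).
exists Q; split => [A|g mg g0]; first by rewrite QE.
rewrite (eq_measure_integral (giry_map mf P)); last by move=> A _ _; exact: QE.
exact: ge0_integral_pushforward.
Qed.

End pushforward.

Section mixture.
Context {d1 d2 d3} {T1 : measurableType d1} {T2 : measurableType d2}
  {T3 : measurableType d3} {R : realType}.

Lemma measurable_fun_nat d (T : measurableType d) d' (T' : measurableType d')
  (n : T -> nat) (F : nat -> T -> T') :
  (forall i, measurable (n @^-1` [set i])) ->
  (forall i, measurable_fun setT (F i)) ->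
  measurable_fun setT (fun w => F (n w) w).
Proof.
move=> mn mF _ B mB; rewrite setTI.
have -> : (fun w => F (n w) w) @^-1` B =
    \bigcup_i (n @^-1` [set i] `&` F i @^-1` B).
  apply/seteqP; split => [w /= Bw|w [i _ [/= <-]]//].
  by exists (n w).
apply: bigcupT_measurable => i; apply: measurableI => //.
by rewrite -[X in measurable X]setTI; exact: mF.
Qed.

(** Bind of the Giry monad along the kernel that sends [w] to the image of
    [Q (n w)] under [F (w, -)]. *)
Lemma mixture (P : probability T1 R) (n : T1 -> nat) (Q : nat -> probability T2 R)
    (F : T1 * T2 -> T3) :
  (forall i, measurable (n @^-1` [set i])) -> measurable_fun setT F ->
  exists Pi : probability T3 R, mixture_law P n Q F Pi.
Proof.
move=> mn mF.
have mFw w : measurable_fun setT (fun v => F (w, v)) by apply: measurableT_comp.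
have mg i g : measurable_fun setT g -> (forall x, 0 <= g x)%E ->
    measurable_fun setT (fun w => \int[Q i]_v g (F (w, v)))%E.
  move=> mg g0.
  apply: (@measurable_fun_fubini_tonelli_F _ _ _ _ _ (Q i) (g \o F)) => [|w]; last exact: g0.
  exact: measurableT_comp.
pose k w : giry T3 R := giry_map (mFw w) (Q (n w)).
have mk : measurable_fun setT k.
  apply: (@measurable_fun_nat _ _ _ _ n (fun i w => giry_map (mFw w) (Q i) : giry T3 R)) => // j.
  apply: measurable_giry_codensity => // B mB.
  have -> : (fun w => giry_map (mFw w) (Q j) B) =
    fun w => (\int[Q j]_v (\1_B (F (w, v)))%:E)%E.
    apply/funext => w; rewrite /giry_map /pushforward.
    have := mFw w measurableT B mB; rewrite setTI => mFB.
    rewrite -[LHS]/((Q j) ((fun v => F (w, v)) @^-1` B)).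
    rewrite -[X in Q j X]setIT -(integral_indic (Q j) measurableT) //.
  apply: (mg j (fun y => (\1_B y)%:E)) => [|y]; last by rewrite lee_fin.
  exact/measurable_EFinP.
have [|Pi PiE] := @measure_probability _ _ R (giry_bind P mk).
  have := giry_int_bind P mk (measurable_cst (1%E : \bar R)) (fun=> lee01).
  rewrite /giry_int !integral_cst//= mul1e => ->.
  rewrite (eq_integral (cst 1%E)) ?probability_integral_cst// => w _.
  by rewrite integral_cst// mul1e; exact: (probability_setT (Q (n w))).
exists Pi => g mg' g0; split.
  apply: (@measurable_fun_nat _ _ _ _ n (fun i w => \int[Q i]_v g (F (w, v)))%E) => // i.
  exact: mg.
rewrite (eq_measure_integral (giry_bind P mk)); last by move=> A _ _; exact: PiE.
have := giry_int_bind P mk mg' g0; rewrite /giry_int => ->.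
apply: eq_integral => w _; exact: ge0_integral_pushforward.
Qed.

End mixture.

(** * Borel sets of a separable normed space *)
Section borel.
Context {R : realType} {X : completeNormedModType R}.

Lemma borel_open (U : set X) : open U -> measurable (U : set (borel X)).
Proof. by move=> oU; exact: sub_sigma_algebra. Qed.

Lemma preim_open_measurable d (T : measurableType d) (f : T -> borel X) :
  (forall U : set X, open U -> measurable (f @^-1` U)) -> measurable_fun setT f.
Proof.
move=> mf; apply: (@measurability _ _ _ (borel X) setT f (@open X)) => //.
by move=> _ [U oU <-]; rewrite setTI; exact: mf.
Qed.

Lemma preim_open_measurableR d (T : measurableType d) (f : T -> R) :
  (forall U : set R, open U -> measurable (f @^-1` U)) -> measurable_fun setT f.
Proof.
move=> mf; apply: (measurability _ (RGenOpens.measurableE R)) => //.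
move=> _ [_ [a [b ->]] <-]; rewrite setTI; apply: mf; exact: interval_open.
Qed.

Lemma continuous_borel (f : X -> X) : continuous f ->
  measurable_fun setT (f : borel X -> borel X).
Proof.
move=> /continuousP cf; apply: preim_open_measurable => U oU.
by apply: borel_open; exact: cf.
Qed.

Lemma continuous_borelR (f : X -> R) : continuous f ->
  measurable_fun setT (f : borel X -> R).
Proof.
move=> /continuousP cf; apply: preim_open_measurableR => U oU.
by apply: borel_open; exact: cf.
Qed.

Context (sepX : separable X).

Lemma dense_seq : exists d : nat -> X, forall x e, 0 < e -> exists i, `|x - d i| < e.
Proof.
have [D cD dD] := sepX.
have [d Dd] : exists d : nat -> X, D `<=` range d.
  have /countable_injP[f injf] := cD.
  exists (fun n => xget 0 [set y | D y /\ f y = n]) => y Dy; exists (f y) => //.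
  case: xgetP => [z -> [Dz fz]|/(_ y)]; last by move=> /not_andP[].
  by apply: injf; rewrite ?inE.
exists d => x e e0.
have [||y [xy Dy]] := dD (ball x e).
- by exists x; exact: ballxx.
- exact: ball_open.
have [i _ iy] := Dd _ Dy; exists i.
by move: xy; rewrite -iy -ball_normE.
Qed.

(** [n y] is the first index of a dense sequence whose [delta]-ball contains [y]. *)
Lemma borel_cells (delta : R) : 0 < delta -> exists (d : nat -> X) (n : X -> nat),
  (forall i, measurable (n @^-1` [set i] : set (borel X))) /\
  forall y, `|y - d (n y)| < delta.
Proof.
move=> d0; have [d dd] := dense_seq.
have ex y : exists i, `|y - d i| < delta by exact: dd.
exists d, (fun y => ex_minn (ex y)); split; last by move=> y; case: ex_minnP.
move=> i.
have -> : (fun y => ex_minn (ex y)) @^-1` [set i] =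
    ball (d i) delta `&` ~` \bigcup_(j < i) ball (d j) delta.
  apply/seteqP; split => y; rewrite -ball_normE /ball_ /=.
    case: ex_minnP => m ym mmin <-; split; first by rewrite distrC.
    by move=> [j /= jm]; rewrite distrC => /mmin; rewrite leqNgt jm.
  move=> [yi ni]; case: ex_minnP => m ym mmin; apply/eqP.
  rewrite eqn_leq mmin 1?distrC//= leqNgt; apply/negP => mi.
  by apply: ni; exists m => //=; rewrite distrC.
apply: measurableI; first by apply: borel_open; exact: ball_open.
apply: measurableC; apply: bigcup_measurable => j _.
by apply: borel_open; exact: ball_open.
Qed.

(** An open set of the product is the union of the products of balls with centres
    in a countable dense set and radii [1 / (k + 1)] that it contains, and there are
    only countably many of those. *)
Lemma prod_open_measurable (U : set (X * X)) : open U ->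
  measurable (U : set (borel X * borel X)).
Proof.
move=> oU; have [d dd] := dense_seq.
pose B i k : set X := ball (d i) k.+1%:R^-1.
pose W (q : nat * nat * nat) : set (X * X) := B q.1.1 q.2 `*` B q.1.2 q.2.
have -> : U = \bigcup_(q in [set q | W q `<=` U]) W q.
  apply/seteqP; split => [[x y] Uxy|z [q /= qU /qU]//].
  have /nbhs_ballP[e /= e0 eU] : nbhs (x, y) U by exact: open_nbhs_nbhs.
  have [k] := @ltr_add_invr R 0 (e / 2) ltac:(lra); rewrite add0r => ke.
  have k0 : 0 < k.+1%:R^-1 :> R by rewrite invr_gt0.
  have [i xi] := dd x _ k0; have [j yj] := dd y _ k0.
  exists (i, j, k); last by split; rewrite /B -ball_normE /ball_ /= distrC.
  move=> [x' y'] [/=]; rewrite /B -!ball_normE /ball_ /= => x'i y'j.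
  apply: eU; split => /=; rewrite -ball_normE /ball_ /=.
    rewrite (le_lt_trans (ler_distD (d i) _ _))// (splitr e).
    by rewrite ltrD// (lt_trans _ ke).
  rewrite (le_lt_trans (ler_distD (d j) _ _))// (splitr e).
  by rewrite ltrD// (lt_trans _ ke).
rewrite bigcup_mkcond; apply: countable_bigcupT_measurable => // q.
case: ifPn => // _.
by apply: measurableX; apply: borel_open; exact: ball_open.
Qed.

Lemma continuous_borel2 (f : X * X -> X) : continuous f ->
  measurable_fun setT (f : borel X * borel X -> borel X).
Proof.
move=> /continuousP cf; apply: preim_open_measurable => U oU.
by apply: prod_open_measurable; exact: cf.
Qed.

Lemma measurable_add2 d (T : measurableType d) (f g : T -> borel X) :
  measurable_fun setT f -> measurable_fun setT g ->
  measurable_fun setT (fun x => (f x : X) + (g x : X) : borel X).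
Proof.
move=> mf mg.
have /continuous_borel2 m2 : continuous (fun z : X * X => z.1 + z.2).
  by move=> z; apply: continuousD; [exact: cvg_fst|exact: cvg_snd].
exact: (measurableT_comp m2 (measurable_fun_pair mf mg)).
Qed.

Lemma measurable_sub2 d (T : measurableType d) (f g : T -> borel X) :
  measurable_fun setT f -> measurable_fun setT g ->
  measurable_fun setT (fun x => (f x : X) - (g x : X) : borel X).
Proof.
move=> mf mg.
have /continuous_borel2 m2 : continuous (fun z : X * X => z.1 - z.2).
  by move=> z; apply: continuousB; [exact: cvg_fst|exact: cvg_snd].
exact: (measurableT_comp m2 (measurable_fun_pair mf mg)).
Qed.

Lemma measurable_normX d (T : measurableType d) (f : T -> borel X) :
  measurable_fun setT f -> measurable_fun setT (fun x => `|f x : X|).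
Proof.
move=> mf; have m2 := continuous_borelR _ (@norm_continuous _ X).
exact: (measurableT_comp m2 mf).
Qed.

End borel.

(** * Convexity and growth of the penalisation *)
Section penalisation.
Context {R : realType}.
Implicit Types (p c t s v w a b : R) (phi f : R -> \bar R).

(** Convexity of the power at [a + b = q * (a / q) + (1 - q) * (b / (1 - q))]. The
    weight [q] stays free: it is chosen as [t / (t + s)] when two penalties are
    added, and the inequality for all [q] at once plays the role of Minkowski's. *)
Lemma powR_split p (q : R) a b : 1 < p -> 0 < q < 1 -> 0 <= a -> 0 <= b ->
  (a + b) `^ p <= q * (q^-1 * a) `^ p + (1 - q) * ((1 - q)^-1 * b) `^ p.
Proof.
move=> p1 /andP[q0 q1] a0 b0.
have q'0 : 0 < 1 - q by rewrite subr_gt0.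
have /(_ (Itv01 (ltW q0) (ltW q1)) (q^-1 * a) ((1 - q)^-1 * b)) := convex_powR (ltW p1).
rewrite !inE /= !in_itv /= !andbT.
rewrite !mulr_ge0 ?invr_ge0 ?(ltW q0) ?(ltW q'0)// => /(_ isT isT) H.
move: H; rewrite convRE => H; rewrite [X in X `^ _ <= _]convRE in H; move: H.
rewrite /= /unstable.onem !mulrA.
by rewrite !divff ?gt_eqF// !mul1r.
Qed.

(** The coefficient [q `^ (1 - p)] tends to [1] with [q]; with
    [q^-1 = (C / A) `^ p^-1] the hypothesis already contradicts [A < C]. *)
Lemma powR_split_lim p (A C : R) : 1 < p -> 0 <= A ->
  (forall q : R, 0 < q < 1 -> C <= q * (q^-1) `^ p * A) -> C <= A.
Proof.
move=> p1; rewrite le_eqVlt => /predU1P[<-|A0] H.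
  by have := H 2^-1; rewrite mulr0; apply; lra.
rewrite leNgt; apply/negP => AC.
pose x := (C / A) `^ p^-1.
have CA : 1 < C / A by rewrite ltr_pdivlMr// mul1r.
have p0 : 0 < p by lra.
have x1 : 1 < x.
  have pi0 : 0 < p^-1 by rewrite invr_gt0.
  have CA0 : C / A \in Num.nneg by rewrite nnegrE; lra.
  by have := gt0_ltr_powR pi0 (ler01 : 1 \in Num.nneg) CA0 CA; rewrite powR1.
have xp : x `^ p = C / A.
  by rewrite /x -powRrM mulVf ?gt_eqF// powRr1//; lra.
have x0 : 0 < x by lra.
have /H : 0 < x^-1 < 1 by rewrite invr_gt0 x0/= invf_lt1.
rewrite invrK xp -mulrA divfK ?gt_eqF// leNgt => /negP; apply.
have C0 : 0 < C by exact: lt_trans AC.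
by rewrite -[ltRHS]mul1r ltr_pM2r// invf_lt1.
Qed.

Section phi.
Context (p c : R) (phi : R -> \bar R).
Context (p1 : 1 < p) (c0 : 0 <= c) (pen : penalisation p phi).

Let p0 : 0 < p. Proof. exact: lt_trans ltr01 p1. Qed.

Lemma phi_ge0 v : 0 <= v -> (0 <= phi v)%E.
Proof. by have [+ _ _ _ _] := pen; apply. Qed.

(** Convexity between [w] and [0], where [phi] vanishes. Monotonicity and coercivity
    of [phi] both follow. *)
Lemma phi_starshaped (l : R) w : 0 <= l <= 1 -> 0 <= w -> (phi (l * w)%R <= l%:E * phi w)%E.
Proof.
move=> l01 w0; have [_ cv _ z _] := pen.
have := cv w 0 l w0 (lexx _) l01.
by rewrite mulr0 addr0 z mule0 adde0.
Qed.

Lemma phi_mono v w : 0 <= v -> v <= w -> (phi v <= phi w)%E.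
Proof.
move=> v0 vw; have w0 := le_trans v0 vw.
move: (w0); rewrite le_eqVlt => /predU1P[we|wgt].
  by have -> : v = w by apply/le_anti; rewrite vw -we.
have l01 : 0 <= v / w <= 1.
  by rewrite divr_ge0//= ler_pdivrMr// mul1r.
have := phi_starshaped _ _ l01 w0; rewrite divfK ?gt_eqF// => /le_trans; apply.
have /andP[l0 l1] := l01.
by rewrite -[leRHS]mul1e lee_wpmul2r ?phi_ge0// lee_fin.
Qed.

Lemma phit0 t : phit c phi t 0 = 0%E.
Proof.
rewrite /phit; case: eqP => _; first by rewrite eqxx.
by have [_ _ _ z _] := pen; rewrite mulr0 mul0r z mule0.
Qed.

Lemma phit_ge0 t v : 0 <= t -> 0 <= v -> (0 <= phit c phi t v)%E.
Proof.
move=> t0 v0; rewrite /phit; case: eqP => _; first by case: eqP.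
by rewrite mule_ge0 ?lee_fin// phi_ge0// divr_ge0// mulr_ge0// expR_ge0.
Qed.

Lemma phit_mono t v w : 0 <= t -> 0 <= v -> v <= w ->
  (phit c phi t v <= phit c phi t w)%E.
Proof.
move=> t0 v0 vw; rewrite /phit; case: eqP => [_|/eqP t1].
  have [w0|w0] := eqVneq w 0; last by rewrite leey.
  have -> : v = 0 by apply/le_anti; rewrite v0 -w0 vw.
  by rewrite eqxx.
rewrite lee_wpmul2l ?lee_fin// phi_mono//.
  by rewrite divr_ge0// mulr_ge0// expR_ge0.
by rewrite ler_pM2r ?invr_gt0 ?lt0r ?t1// ler_wpM2l// expR_ge0.
Qed.

(** Beyond a point where [phi] is positive, [phi] grows at least linearly. *)
Lemma phit_coercive t (C : R) : 0 <= t -> exists D, forall v, 0 <= v ->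
  (phit c phi t v <= C%:E)%E -> v <= D.
Proof.
rewrite le_eqVlt => /predU1P[<-|t0].
  exists 0 => v v0; rewrite /phit eqxx; case: eqP => [->//|_].
  by rewrite leye_eq.
have [_ _ _ z [[v1 v1pos phv1] _]] := pen.
have [d [d0 dphi]] : exists d : R, 0 < d /\ (d%:E <= phi v1)%E.
  have := phi_ge0 _ (ltW v1pos); case: (phi v1) phv1 => [r| |]//.
    move=> rn0; rewrite lee_fin le_eqVlt => /predU1P[r0|r0]; first by rewrite -r0 in rn0.
    by exists r.
  by move=> _ _; exists 1; split; [exact: ltr01|rewrite leey].
have C'0 : 0 <= `|C| by [].
exists ((v1 + v1 * `|C| / (t * d)) * t * expR (c * t)) => v v0.
rewrite /phit gt_eqF// => H.
set w := expR (- (c * t)) * v / t in H.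
have vE : v = w * t * expR (c * t).
  rewrite /w expRN; field.
  by rewrite !gt_eqF ?expR_gt0.
rewrite vE ler_wpM2r ?expR_ge0// ler_wpM2r ?(ltW t0)//.
have w0 : 0 <= w by rewrite /w divr_ge0 ?(ltW t0)// mulr_ge0 ?expR_ge0.
have [wv1|v1w] := leP w v1.
  by rewrite (le_trans wv1)// lerDl divr_ge0 ?mulr_ge0// ltW.
have wpos : 0 < w by lra.
have l01 : 0 <= v1 / w <= 1.
  by rewrite divr_ge0 ?(ltW v1pos)//= ler_pdivrMr// mul1r ltW.
have := phi_starshaped _ _ l01 w0; rewrite divfK ?gt_eqF// => H2.
have := le_trans dphi H2.
move: H; have := phi_ge0 _ w0; case: (phi w) => [r| |]//; last first.
  by rewrite mulry gtr0_sg// mul1e leye_eq.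
rewrite !lee_fin => r0 trC dr.
apply: (@le_trans _ _ (v1 * `|C| / (t * d))); last first.
  by rewrite lerDr ltW.
rewrite ler_pdivlMr ?mulr_gt0//.
have dw : d * w <= v1 * r.
  by move: dr; rewrite mulrAC ler_pdivlMr.
have CC := ler_norm C.
have -> : w * (t * d) = (d * w) * t by ring.
rewrite (le_trans (ler_wpM2r (ltW t0) dw))// -mulrA ler_pM2l// mulrC.
by rewrite (le_trans trC).
Qed.

(** The penalty as a function of the transport cost, the [p]-th power of the
    distance. In this variable it is convex. *)
Definition Phi t v := phit c phi t (v `^ p^-1).

Lemma Phi_ge0 t v : 0 <= t -> (0 <= Phi t v)%E.
Proof. by move=> t0; rewrite phit_ge0// powR_ge0. Qed.

Lemma Phi0 t : Phi t 0 = 0%E.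
Proof. by rewrite /Phi powR0 ?phit0// invr_eq0 gt_eqF. Qed.

Lemma Phi_mono t v w : 0 <= t -> 0 <= v -> v <= w -> (Phi t v <= Phi t w)%E.
Proof.
move=> t0 v0 vw; rewrite phit_mono ?powR_ge0// ge0_ler_powR ?invr_ge0 ?nnegrE//.
  exact: ltW.
exact: le_trans vw.
Qed.

Lemma Phi_time0 v a : 0 <= v -> (Phi 0 v <= a%:E)%E -> v = 0.
Proof.
move=> v0; rewrite /Phi /phit eqxx; case: eqP => [+ _|_]; last by rewrite leye_eq.
by move=> /powR_eq0_eq0.
Qed.

Let rho v := phi (v `^ p^-1).
Let kap t := (expR (- (c * t)) / t) `^ p.

(** Both the discount [expR (- (c * t))] and the division by [t] become a factor in
    front of the cost. *)
Lemma PhiE t v : 0 < t -> 0 <= v -> Phi t v = (t%:E * rho (kap t * v)%R)%E.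
Proof.
move=> t0 v0; rewrite /Phi /phit gt_eqF// /rho powRM ?powR_ge0//.
rewrite /kap -powRrM divff ?gt_eqF// powRr1; last first.
  by rewrite divr_ge0 ?expR_ge0// ltW.
by rewrite mulrAC.
Qed.

Let rho_mono v w : 0 <= v -> v <= w -> (rho v <= rho w)%E.
Proof.
move=> v0 vw; rewrite phi_mono ?powR_ge0// ge0_ler_powR ?invr_ge0 ?nnegrE//.
  exact: ltW.
exact: le_trans vw.
Qed.

Let Phi_fin t v a : 0 < t -> 0 <= v -> (Phi t v <= a%:E)%E ->
  exists r, rho (kap t * v) = r%:E /\ t * r <= a.
Proof.
move=> t0 v0; rewrite PhiE//.
have : (0 <= rho (kap t * v)%R)%E by rewrite phi_ge0 ?powR_ge0.
case: (rho _) => [r| |]//; last by rewrite mulry gtr0_sg// mul1e leye_eq.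
by move=> _; rewrite -EFinM lee_fin => tra; exists r.
Qed.

Let kap_ge0 t : 0 <= kap t. Proof. exact: powR_ge0. Qed.

Let rho_conv v w (l r : R) (r' : R) : 0 <= v -> 0 <= w -> 0 <= l <= 1 ->
  rho v = r%:E -> rho w = r'%:E ->
  (rho (l * v + (1 - l) * w)%R <= (l * r + (1 - l) * r')%:E)%E.
Proof.
move=> v0 w0 l01 hr hr'; have [_ _ _ _ [_ cv]] := pen.
by have := cv v w l v0 w0 l01; rewrite -!/(rho _) hr hr'.
Qed.

Lemma Phi_convex t v w (l : R) a b : 0 <= t -> 0 <= v -> 0 <= w -> 0 <= l <= 1 ->
  (Phi t v <= a%:E)%E -> (Phi t w <= b%:E)%E ->
  (Phi t (l * v + (1 - l) * w)%R <= (l * a + (1 - l) * b)%:E)%E.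
Proof.
rewrite le_eqVlt => /predU1P[<-|t0] v0 w0 /andP[l0 l1] ha hb.
  have a0 : 0 <= a by rewrite -lee_fin (le_trans _ ha)// Phi_ge0.
  have b0 : 0 <= b by rewrite -lee_fin (le_trans _ hb)// Phi_ge0.
  rewrite (Phi_time0 _ _ v0 ha) (Phi_time0 _ _ w0 hb) !mulr0 addr0 Phi0 lee_fin.
  by rewrite addr_ge0// mulr_ge0// subr_ge0.
have l'0 : 0 <= 1 - l by rewrite subr_ge0.
have [r [hr ra]] := Phi_fin _ _ _ t0 v0 ha.
have [r' [hr' rb]] := Phi_fin _ _ _ t0 w0 hb.
rewrite PhiE ?addr_ge0 ?mulr_ge0//.
have -> : kap t * (l * v + (1 - l) * w) =
  l * (kap t * v) + (1 - l) * (kap t * w) by ring.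
have l01 : 0 <= l <= 1 by rewrite l0.
have := rho_conv _ _ l _ _ (mulr_ge0 (kap_ge0 t) v0) (mulr_ge0 (kap_ge0 t) w0) l01 hr hr'.
have : (0%E <= t%:E)%E by rewrite lee_fin ltW.
move=> /lee_wpmul2l/[apply]/le_trans; apply.
rewrite -EFinM lee_fin mulrDr !(mulrCA t) lerD// ler_wpM2l//.
Qed.

(** The missing mass [1 - \sum P] sits at [0], where [Phi] vanishes; this is why
    weights of total mass below [1] are allowed. *)
Lemma Phi_jensen t N (P v q : nat -> R) : 0 <= t ->
  (forall i, (i < N)%N -> [/\ 0 <= P i, 0 <= v i & (Phi t (v i) <= (q i)%:E)%E]) ->
  \sum_(0 <= i < N) P i <= 1 ->
  (Phi t (\sum_(0 <= i < N) P i * v i)%R <= (\sum_(0 <= i < N) P i * q i)%R%:E)%E.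
Proof.
move=> t0; elim: N P => [|N IH] P H; first by rewrite !big_geq// Phi0.
rewrite !big_nat_recr//=; set S := \sum_(0 <= i < N) P i * v i => P1.
have H' i : (i < N)%N -> [/\ 0 <= P i, 0 <= v i & (Phi t (v i) <= (q i)%:E)%E].
  by move=> iN; apply: H; exact: leqW.
have [PN vN qN] := H N (leqnn _).
have SP : 0 <= \sum_(0 <= i < N) P i.
  by rewrite big_nat sumr_ge0// => i /andP[_ /H'[]].
have r0 : 0 <= 1 - P N by lra.
have S0 : 0 <= S.
  by rewrite /S big_nat sumr_ge0// => i /andP[_ /H'[Pi vi _]]; rewrite mulr_ge0.
have [re|rn] := eqVneq (1 - P N) 0.
  have Pi i : (i < N)%N -> P i = 0.
    have : \sum_(i < N) P i == 0.
      by rewrite -(big_mkord xpredT); apply/eqP; lra.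
    rewrite psumr_eq0 => [/allP h iN|j _]; last by have [] := H' j (ltn_ord j).
    by have := h (Ordinal iN); rewrite mem_index_enum => /(_ isT)/implyP/(_ isT)/eqP.
  have PN1 : P N = 1 by lra.
  have Z (g : nat -> R) : \sum_(0 <= i < N) P i * g i = 0.
    by rewrite big_nat big1// => i /andP[_ iN]; rewrite Pi// mul0r.
  by rewrite /S !Z PN1 !add0r !mul1r.
have rp : 0 < 1 - P N by rewrite lt0r rn.
have Z (g : nat -> R) : \sum_(0 <= i < N) P i / (1 - P N) * g i =
    (\sum_(0 <= i < N) P i * g i) / (1 - P N).
  by rewrite mulr_suml; apply: eq_bigr => i _; rewrite mulrAC.
have {}IH : (Phi t (S / (1 - P N))%R <= ((\sum_(0 <= i < N) P i * q i) / (1 - P N))%:E)%E.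
  rewrite /S -!Z; apply: IH => [i /H'[Pi vi qi]|]; first by split=> //; rewrite divr_ge0.
  by rewrite -mulr_suml ler_pdivrMr// mul1r; lra.
have l01 : 0 <= P N <= 1 by lra.
have := Phi_convex _ _ _ _ _ _ t0 vN (divr_ge0 S0 r0) l01 qN IH.
by rewrite ![(1 - P N) * _]mulrC !divfK// ![P N * _ + _]addrC.
Qed.

(** The reason for the discount and for the scaling in [phit]: with
    [q = t / (t + s)] the bound on [C], once rescaled as in [PhiE], is at most
    the convex combination with weights [q] and [1 - q] of the rescaled [A] and [B]. When one
    of the times is [0] the corresponding cost vanishes and [q] is sent to the
    boundary. *)
Lemma Phi_add t s (A B C al be : R) : 0 <= t -> 0 <= s ->
  0 <= A -> 0 <= B -> 0 <= C ->
  (forall q : R, 0 < q < 1 -> C <= q * (q^-1 * expR (c * s)) `^ p * A +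
                              (1 - q) * ((1 - q)^-1) `^ p * B) ->
  (Phi t A <= al%:E)%E -> (Phi s B <= be%:E)%E -> (Phi (t + s)%R C <= (al + be)%:E)%E.
Proof.
move=> t0 s0 A0 B0 C0 H hA hB.
have al0 : 0 <= al by rewrite -lee_fin (le_trans _ hA)// Phi_ge0.
have be0 : 0 <= be by rewrite -lee_fin (le_trans _ hB)// Phi_ge0.
move: (t0); rewrite le_eqVlt => /predU1P[te|tpos].
  subst t; rewrite add0r.
  have CB : C <= B.
    apply: (powR_split_lim _ _ _ p1) => // q q01.
    have := H (1 - q) ltac:(lra); rewrite (Phi_time0 _ _ A0 hA) mulr0 add0r.
    by rewrite opprB addrCA subrr addr0.
  apply: le_trans (Phi_mono _ _ _ s0 C0 CB) _.
  by apply: le_trans hB _; rewrite lee_fin lerDr.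
move: (s0); rewrite le_eqVlt => /predU1P[se|spos].
  subst s; rewrite addr0.
  have CA : C <= A.
    apply: (powR_split_lim _ _ _ p1) => // q q01.
    by have := H _ q01; rewrite (Phi_time0 _ _ B0 hB) !mulr0 addr0 expR0 mulr1.
  apply: le_trans (Phi_mono _ _ _ t0 C0 CA) _.
  by apply: le_trans hA _; rewrite lee_fin lerDl.
have [r [hr ra]] := Phi_fin _ _ _ tpos A0 hA.
have [r' [hr' rb]] := Phi_fin _ _ _ spos B0 hB.
have ts : 0 < t + s by lra.
pose q := t / (t + s).
have q01 : 0 < q < 1.
  by rewrite divr_gt0//= ltr_pdivrMr// mul1r; lra.
have q01' : 0 <= q <= 1 by lra.
have q' : 1 - q = s / (t + s) by rewrite /q; field; rewrite gt_eqF.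
rewrite PhiE//.
have tsi : 0 <= (t + s)^-1 by rewrite invr_ge0 ltW.
have qi : 0 <= q^-1 by rewrite invr_ge0; lra.
have q'i : 0 <= (1 - q)^-1 by rewrite invr_ge0; lra.
have e1 : kap (t + s) * (q^-1 * expR (c * s)) `^ p = kap t.
  rewrite /kap -powRM ?mulr_ge0 ?expR_ge0//.
  congr (_ `^ p); rewrite mulrDr opprD expRD (expRN (c * s)) /q; field.
  by rewrite !gt_eqF ?expR_gt0.
have e2 : kap (t + s) * ((1 - q)^-1) `^ p <= kap s.
  rewrite /kap -powRM ?mulr_ge0 ?expR_ge0//.
  have -> : expR (- (c * (t + s))) / (t + s) * (1 - q)^-1 =
            expR (- (c * (t + s))) / s by rewrite q'; field; rewrite !gt_eqF.
  rewrite ge0_ler_powR ?(ltW p0) ?nnegrE ?divr_ge0 ?expR_ge0 ?(ltW spos)//.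
  by rewrite ler_pM2r ?invr_gt0// ler_expR lerN2 ler_wpM2l// lerDr.
have kC : kap (t + s) * C <= q * (kap t * A) + (1 - q) * (kap s * B).
  apply: le_trans (ler_wpM2l (kap_ge0 _) (H _ q01)) _.
  have -> : kap (t + s) * (q * (q^-1 * expR (c * s)) `^ p * A + (1 - q) * (1 - q)^-1 `^ p * B)
    = q * ((kap (t + s) * (q^-1 * expR (c * s)) `^ p) * A) +
      (1 - q) * ((kap (t + s) * (1 - q)^-1 `^ p) * B) by ring.
  rewrite e1 lerD2l ler_wpM2l ?ler_wpM2r//; lra.
have h0 : 0 <= kap (t + s) * C by rewrite mulr_ge0.
have h1 := le_trans (rho_mono _ _ h0 kC)
  (rho_conv _ _ q _ _ (mulr_ge0 (kap_ge0 t) A0) (mulr_ge0 (kap_ge0 s) B0) q01' hr hr').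
have ts0 : (0%E <= (t + s)%:E)%E by rewrite lee_fin ltW.
apply: le_trans (lee_wpmul2l ts0 h1) _.
rewrite -EFinM lee_fin q' /q.
have -> : (t + s) * (t / (t + s) * r + s / (t + s) * r') = t * r + s * r'.
  by field; rewrite gt_eqF.
by rewrite lerD.
Qed.

End phi.
End penalisation.

(** * Integrals of powers *)
Section power_integrals.
Context {d} {T : measurableType d} {R : realType}.
Context (P : probability T R) (p : R) (p1 : 1 < p).
Implicit Types (f g V : T -> R).

Lemma measurable_pow f : measurable_fun setT f ->
  measurable_fun setT (fun x => (f x `^ p)%:E).
Proof.
move=> mf; apply/measurable_EFinP.
exact: (measurableT_comp (measurable_powR p) mf).
Qed.

Lemma measurable_Zpow (k : R) f : measurable_fun setT f ->
  measurable_fun setT (fun x => k * f x `^ p).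
Proof.
move=> mf; apply: measurable_funM => //; exact/measurable_EFinP/measurable_pow.
Qed.

Lemma integral_powRZl (k : R) f : 0 <= k -> measurable_fun setT f ->
  (\int[P]_x (k * f x `^ p)%:E = k%:E * \int[P]_x (f x `^ p)%:E)%E.
Proof.
move=> k0 mf; rewrite -ge0_integralZl_EFin//.
- by move=> x _; rewrite lee_fin powR_ge0.
- exact: measurable_pow.
Qed.

Lemma integral_powR_split f g V (k q : R) : measurable_fun setT f ->
  measurable_fun setT g -> measurable_fun setT V ->
  (forall x, [/\ 0 <= f x, 0 <= g x & 0 <= V x <= k * f x + g x]) ->
  0 <= k -> 0 < q < 1 ->
  (\int[P]_x (V x `^ p)%:E <=
    (q * (q^-1 * k) `^ p)%:E * \int[P]_x (f x `^ p)%:E +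
    ((1 - q) * ((1 - q)^-1) `^ p)%:E * \int[P]_x (g x `^ p)%:E)%E.
Proof.
move=> mf mg mV H k0 q01; have /andP[q0 q1] := q01.
have q'0 : 0 < 1 - q by rewrite subr_gt0.
have A0 : 0 <= q * (q^-1 * k) `^ p by rewrite mulr_ge0 ?powR_ge0// ltW.
have B0 : 0 <= (1 - q) * ((1 - q)^-1) `^ p by rewrite mulr_ge0 ?powR_ge0// ltW.
have mZ (k' : R) (h : T -> R) : measurable_fun setT h ->
    measurable_fun setT (fun x => (k' * h x `^ p)%:E).
  by move=> mh; exact/measurable_EFinP/measurable_Zpow.
have Z0 (k' : R) (h : T -> R) : 0 <= k' -> forall x, setT x -> (0 <= (k' * h x `^ p)%:E)%E.
  by move=> k'0 x _; rewrite lee_fin mulr_ge0// powR_ge0.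
rewrite -!integral_powRZl//.
rewrite -(ge0_integralD P measurableT (Z0 _ f A0) (mZ _ f mf) (Z0 _ g B0) (mZ _ g mg)).
apply: ge0_le_integral => //.
- by move=> x _; rewrite lee_fin powR_ge0.
- exact: measurable_pow.
- by apply/measurable_EFinP; apply: measurable_funD; exact: measurable_Zpow.
move=> x _; have [f0 g0 /andP[V0 Vfg]] := H x.
have kf : 0 <= k * f x by rewrite mulr_ge0.
rewrite lee_fin; apply: (@le_trans _ _ ((k * f x + g x) `^ p)).
  by rewrite ge0_ler_powR ?nnegrE ?addr_ge0// (le_trans _ (ltW p1)).
apply: le_trans (powR_split _ _ _ _ p1 q01 kf g0) _.
rewrite mulrA powRM ?mulr_ge0 ?invr_ge0 ?(ltW q0)//.
by rewrite [X in _ + _ * X <= _]powRM ?invr_ge0 ?(ltW q'0)// !mulrA.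
Qed.

Lemma integral_powR_sum f g V (a b : R) : measurable_fun setT f ->
  measurable_fun setT g -> measurable_fun setT V ->
  (forall x, [/\ 0 <= f x, 0 <= g x & 0 <= V x <= f x + g x]) ->
  (\int[P]_x (f x `^ p)%:E <= a%:E)%E -> (\int[P]_x (g x `^ p)%:E <= b%:E)%E ->
  (\int[P]_x (V x `^ p)%:E <= (2 `^ p * (a + b))%:E)%E.
Proof.
move=> mf mg mV H fa gb.
have q01 : 0 < (2^-1 : R) < 1 by lra.
have := @integral_powR_split f g V 1 2^-1 mf mg mV.
move=> /(_ _ ler01 q01); rewrite mulr1 (_ : 1 - 2^-1 = 2^-1 :> R); last by lra.
rewrite invrK => H'; apply: le_trans (H' _) _ => [x|].
  by have [f0 g0] := H x; rewrite mul1r.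
have k0 : 0 <= 2^-1 * 2 `^ p :> R by rewrite mulr_ge0 ?powR_ge0.
have k0e : (0 <= (2^-1 * 2 `^ p)%:E :> \bar R)%E by rewrite lee_fin.
apply: (le_trans (leeD (lee_wpmul2l k0e fa) (lee_wpmul2l k0e gb))).
rewrite -!EFinM -EFinD lee_fin -mulrDr ler_wpM2r//; last first.
  by rewrite ler_piMl ?powR_ge0//; lra.
have f0 : (0 <= \int[P]_x (f x `^ p)%:E)%E.
  by apply: integral_ge0 => x _; rewrite lee_fin powR_ge0.
have g0 : (0 <= \int[P]_x (g x `^ p)%:E)%E.
  by apply: integral_ge0 => x _; rewrite lee_fin powR_ge0.
by rewrite addr_ge0// -lee_fin; [exact: le_trans fa|exact: le_trans gb].
Qed.

Lemma le_one_pow (x : R) : 0 <= x -> x <= 1 + x `^ p.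
Proof.
move=> x0; have [x1|x1] := leP x 1; first by rewrite (le_trans x1)// lerDl powR_ge0.
apply: (@le_trans _ _ (x `^ p)); last by rewrite lerDr.
by rewrite -{1}(powRr1 x0) ler_powR ?(ltW x1)// ltW.
Qed.

End power_integrals.

(** * Image laws in terms of sets *)
Section laws.
Context {d1 d2} {T1 : measurableType d1} {T2 : measurableType d2} {R : realType}.
Implicit Types (P : probability T1 R) (Q : probability T2 R) (f : T1 -> T2).

Lemma law_of_sets P f Q : measurable_fun setT f ->
  (forall A, measurable A -> P (f @^-1` A) = Q A) -> image_law P f Q.
Proof.
move=> mf PQ g mg g0.
rewrite (eq_measure_integral (giry_map mf P)); last by move=> A mA _; exact/esym/PQ.
exact: ge0_integral_pushforward.
Qed.

Lemma sets_of_law P f Q : measurable_fun setT f -> image_law P f Q ->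
  forall A, measurable A -> P (f @^-1` A) = Q A.
Proof.
move=> mf PQ A mA.
have mfA : measurable (f @^-1` A) by rewrite -[X in measurable X]setTI; exact: mf.
rewrite -[A in RHS]setIT -(integral_indic Q measurableT)//.
rewrite (PQ (fun y => (\1_A y)%:E)); first last.
- by move=> y; rewrite lee_fin.
- exact/measurable_EFinP.
by rewrite -[X in P X]setIT -(integral_indic P measurableT).
Qed.

End laws.

(** * Transport costs *)
Section wasserstein.
Context {R : realType} {X : completeNormedModType R} (sepX : separable X).
Context (p : R) (p1 : 1 < p).
Notation bX := (borel X).
Notation bX2 := (borel X * borel X)%type.
Implicit Types (mu nu : probability bX R) (pi : probability bX2 R).

Definition cost pi := (\int[pi]_w (`|(w.1 : X) - (w.2 : X)| `^ p)%:E)%E.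

Lemma cost_ge0 pi : (0 <= cost pi)%E.
Proof. by apply: integral_ge0 => w _; rewrite lee_fin powR_ge0. Qed.

Lemma measurable_dist :
  measurable_fun setT (fun w : bX2 => `|(w.1 : X) - (w.2 : X)|).
Proof.
apply: measurable_normX; exact: measurable_sub2.
Qed.

Lemma Cpl_laws mu nu pi :
  Cpl mu nu pi <-> image_law pi fst mu /\ image_law pi snd nu.
Proof.
split=> [H|[h1 h2] A mA].
  by split; apply: law_of_sets => // A /H[].
by split; exact: sets_of_law.
Qed.

Lemma moment_le_cost mu nu pi (a b : R) : image_law pi fst mu -> image_law pi snd nu ->
  (moment p mu <= a%:E)%E -> (cost pi <= b%:E)%E -> (moment p nu <= (2 `^ p * (a + b))%:E)%E.
Proof.
move=> h1 h2 ma cb.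
have mn : measurable_fun setT (fun y : bX => `|y : X|) by exact: measurable_normX.
rewrite /moment (h2 (fun y => (`|y : X| `^ p)%:E)); first last.
- by move=> y; rewrite lee_fin powR_ge0.
- exact: (measurable_pow p).
apply: (@integral_powR_sum _ _ _ pi p p1 (fun w => `|w.1 : X|)
  (fun w => `|(w.1 : X) - (w.2 : X)|)) => //.
- exact: measurable_normX.
- exact: measurable_dist.
- exact: measurable_normX.
- move=> w; split=> //; rewrite normr_ge0/=.
  by rewrite -[X in `|X|](subKr (w.1 : X)) ler_normB.
- rewrite -(h1 (fun y => (`|y : X| `^ p)%:E))//.
  exact: (measurable_pow p).
Qed.

(** Only serves to make the infimum in [Wp] finite. *)
Lemma product_coupling mu nu : Pp p mu -> Pp p nu ->
  exists pi, [/\ image_law pi fst mu, image_law pi snd nu & (cost pi < +oo)%E].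
Proof.
move=> hmu hnu.
have mid : measurable_fun setT (@id bX2) by exact: measurable_id.
have m0 i : measurable ((fun=> 0%N) @^-1` [set i] : set bX).
  by rewrite preimage_cst; case: ifP.
have [pi hpi] := @mixture _ _ _ _ _ _ R mu (fun=> 0%N) (fun=> nu) (@id bX2) m0 mid.
have h1 : image_law pi fst mu.
  move=> g mg g0; have [_ ->//] := hpi (fun w => g w.1)
    (measurableT_comp mg measurable_fst) (fun w => g0 _).
  by apply: eq_integral => w _; rewrite /= (probability_integral_cst nu (g w)).
have h2 : image_law pi snd nu.
  move=> g mg g0; have [_ ->//] := hpi (fun w => g w.2)
    (measurableT_comp mg measurable_snd) (fun w => g0 _).
  by rewrite /= (probability_integral_cst mu).
exists pi; split=> //.
have m1 : measurable_fun setT (fun y : bX => `|y : X|) by exact: measurable_normX.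
have n0 y : (0 <= (`|y : X| `^ p)%:E)%E by rewrite lee_fin powR_ge0.
have fin (q : probability bX R) : Pp p q -> (moment p q <= (fine (moment p q))%:E)%E.
  by move=> hq; rewrite fineK// ge0_fin_numE//; apply: integral_ge0.
apply: (le_lt_trans (@integral_powR_sum _ _ _ pi p p1 (fun w => `|w.1 : X|)
    (fun w => `|w.2 : X|) (fun w => `|(w.1 : X) - (w.2 : X)|)
   (fine (moment p mu)) (fine (moment p nu)) _ _ _ _ _ _)); last exact: ltry.
- by apply: measurable_normX; exact: measurable_fst.
- by apply: measurable_normX; exact: measurable_snd.
- exact: measurable_dist.
- by move=> w; split=> //; rewrite normr_ge0 ler_normB.
- rewrite -(h1 (fun y => (`|y : X| `^ p)%:E))//; first exact: fin.
  exact: (measurable_pow p).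
- rewrite -(h2 (fun y => (`|y : X| `^ p)%:E))//; first exact: fin.
  exact: (measurable_pow p).
Qed.

(** [cs] is the infimum of the costs of the couplings, so that
    [phit c phi t (fine (Wp p mu nu))] is [Phi t cs]. *)
Lemma Wp_spec mu nu : Pp p mu -> Pp p nu -> exists cs : R,
  [/\ 0 <= cs, fine (Wp p mu nu) = cs `^ p^-1,
    (forall e, 0 < e -> exists pi, [/\ image_law pi fst mu, image_law pi snd nu &
        (cost pi <= (cs + e)%:E)%E]) &
    (forall pi, image_law pi fst mu -> image_law pi snd nu -> (cs%:E <= cost pi)%E)].
Proof.
move=> hmu hnu; have [pi0 [h1 h2 h3]] := product_coupling _ _ hmu hnu.
rewrite /Wp; set S := [set _ | _ in _].
have S0 : S (cost pi0) by exists pi0 => //; apply/Cpl_laws.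
have I0 : (0 <= ereal_inf S)%E.
  by apply: le_ereal_inf_tmp => _ [pi _ <-]; exact: cost_ge0.
have Ifin : ereal_inf S \is a fin_num.
  by rewrite ge0_fin_numE// (le_lt_trans _ h3)// ereal_inf_lbound.
exists (fine (ereal_inf S)); split.
- exact: fine_ge0.
- by rewrite -{1}(fineK Ifin) poweR_EFin.
- move=> e e0; have [_ [pi Cpi <-] H] := lb_ereal_inf_adherent e0 Ifin.
  have /Cpl_laws[? ?] := Cpi; exists pi; split=> //.
  by rewrite EFinD fineK// ltW.
- move=> pi h1' h2'; rewrite fineK// ereal_inf_lbound//.
  by exists pi => //; apply/Cpl_laws.
Qed.

Lemma lip_bmeas (f : X -> R) (L M : R) : 0 <= L -> (forall x, `|f x| <= M) ->
  (forall x y, `|f x - f y| <= L * `|x - y|) -> bmeas (f : bX -> R).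
Proof.
move=> L0 fM fL; split; last by exists M.
apply: continuous_borelR => x; apply/cvgrPdist_lt => e e0.
have L1 : 0 < L + 1 by rewrite ltr_wpDl.
apply/nbhs_ballP; exists (e / (L + 1)) => /=; first by rewrite divr_gt0.
move=> y; rewrite -ball_normE /ball_ /= => xy.
rewrite (le_lt_trans (fL _ _))// (@le_lt_trans _ _ ((L + 1) * `|x - y|))//.
  by rewrite ler_wpM2r// lerDl.
by rewrite mulrC -ltr_pdivlMr.
Qed.

Lemma diag_coupling (m : probability bX R) : exists pi : probability bX2 R,
  [/\ image_law pi fst m, image_law pi snd m & cost pi = 0%E].
Proof.
have md : measurable_fun setT (fun y : bX => (y, y) : bX2).
  by apply: measurable_fun_pair; exact: measurable_id.
have [pi [_ hpi]] := pushforward_probability m (fun y : bX => (y, y) : bX2) md.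
exists pi; split.
- move=> g mg g0; rewrite (hpi (fun w => g w.1))//.
  by apply: (measurableT_comp mg); exact: measurable_fst.
- move=> g mg g0; rewrite (hpi (fun w => g w.2))//.
  by apply: (measurableT_comp mg); exact: measurable_snd.
rewrite /cost (hpi (fun w => (`|(w.1 : X) - (w.2 : X)| `^ p)%:E)); first last.
- by move=> w; rewrite lee_fin powR_ge0.
- exact: (measurable_pow p _ measurable_dist).
rewrite (eq_integral (cst 0%E)) ?integral0//.
by move=> w _ /=; rewrite subrr normr0 powR0// gt_eqF// (lt_trans ltr01 p1).
Qed.

(** A cost slightly above the infimum [cs] may already have infinite penalty. Moving
    the second component a little towards the first shrinks the distance, hence
    brings the cost of a nearly optimal coupling down to [cs], at the price of
    changing the second marginal; a Lipschitz function hardly notices. *)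
Lemma contract_coupling mu nu (cs L M e : R) (f : X -> R) :
  0 <= cs ->
  (forall e, 0 < e -> exists pi, [/\ image_law pi fst mu, image_law pi snd nu &
        (cost pi <= (cs + e)%:E)%E]) ->
  0 <= L -> (forall x, `|f x| <= M) -> (forall x y, `|f x - f y| <= L * `|x - y|) ->
  0 < e -> exists pi, [/\ image_law pi fst mu, (cost pi <= cs%:E)%E &
    \int[nu]_z f (z : X) <= \int[pi]_w f (w.2 : X) + e].
Proof.
move=> cs0 app L0 fM fL e0.
have bf := lip_bmeas _ _ _ L0 fM fL.
have mpow (k : R) : measurable_fun setT
    (fun w : bX2 => k * `|(w.1 : X) - (w.2 : X)| `^ p).
  exact: (@measurable_Zpow _ _ R p k (fun w : bX2 => `|(w.1 : X) - (w.2 : X)|) measurable_dist).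
have ipow (pi0 : probability bX2 R) (k : R) : 0 <= k ->
    (\int[pi0]_w (k * `|(w.1 : X) - (w.2 : X)| `^ p)%:E = k%:E * cost pi0)%E.
  move=> k0; apply: (@integral_powRZl _ _ _ pi0 p k
    (fun w : bX2 => `|(w.1 : X) - (w.2 : X)|)) => //.
  exact: measurable_dist.
have p0 : 0 < p by exact: lt_trans p1.
have b1 : bmeas (fun w : bX2 => f (w.1 : X)) by exact: bmeas_comp.
have b2 : bmeas (fun w : bX2 => f (w.2 : X)) by exact: bmeas_comp.
move: cs0; rewrite le_eqVlt => /predU1P[cse|cspos].
  subst cs.
  (* Zero infimum: the second component is moved all the way onto the first one.
     The bound [d <= k * (1 + (d / k) `^ p)] trades the distance [d] for the cost. *)
  pose k := e / (2 * (L + 1)).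
  have k0 : 0 < k by rewrite divr_gt0// mulr_gt0// ltr_wpDl.
  have Lk : L * k <= e / 2.
    rewrite /k mulrA ler_pdivrMr ?mulr_gt0 ?ltr_wpDl//.
    have -> : e / 2 * (2 * (L + 1)) = L * e + e by field.
    by rewrite lerDl ltW.
  pose B := L * k * k^-1 `^ p.
  have B0 : 0 <= B.
    by apply: mulr_ge0 (powR_ge0 _ _); apply: mulr_ge0 => //; exact: ltW.
  have e'0 : 0 < e / (2 * (B + 1)) by rewrite divr_gt0// mulr_gt0// ltr_wpDl.
  have [pi0 [h1 h2 h3]] := app _ e'0.
  have [pi [hpi hpi2 cpi]] := diag_coupling mu.
  exists pi; split => //; first by rewrite cpi.
  - rewrite -(image_law_Rint _ _ _ _ measurable_snd hpi2 bf).
    rewrite (image_law_Rint _ _ _ _ measurable_snd h2 bf).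
    rewrite (image_law_Rint _ _ _ _ measurable_fst h1 bf).
    rewrite (splitr e).
    apply: (@le_trans _ _ (\int[pi0]_w f (w.1 : X) + (L * k + e / 2))).
      2: by rewrite lerD2l lerD2r.
    apply: (Rint_le_add _ _ _ (fun w : bX2 => B * `|(w.1 : X) - (w.2 : X)| `^ p)) => //.
    + by move=> w; rewrite mulr_ge0// powR_ge0.
    + rewrite ipow//; apply: (le_trans (lee_wpmul2l _ h3)); first by rewrite lee_fin.
      rewrite add0r -EFinM lee_fin mulrA ler_pdivrMr ?mulr_gt0 ?ltr_wpDl//.
      have -> : e / 2 * (2 * (B + 1)) = B * e + e by field.
      by rewrite lerDl ltW.
    + move=> w; rewrite -lerBlDl; apply: (le_trans (ler_norm _)).
      apply: (le_trans (fL _ _)); rewrite distrC.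
      set a := `|_|; have a0 : 0 <= a by exact: normr_ge0.
      have -> : L * k + B * a `^ p = L * k * (1 + (k^-1 * a) `^ p).
        by rewrite powRM ?invr_ge0 ?(ltW k0)// /B; ring.
      have -> : L * a = L * k * (k^-1 * a) by field; rewrite gt_eqF.
      apply: ler_wpM2l; first by apply: mulr_ge0 => //; exact: ltW.
      apply: le_one_pow => //; apply: mulr_ge0 => //.
      by rewrite invr_ge0 ltW.
pose D := (L + 1) * (1 + 2 * cs).
have D0 : 0 < D by rewrite mulr_gt0 ?ltr_wpDl//; lra.
(* The contraction factor [l] is fixed first, from the Lipschitz constant; the
   coupling is then taken so close to optimal that [(1 - l) `^ p] times its cost
   is at most [cs], while its cost stays below [2 * cs]. *)
pose l := Num.min 2^-1 (e / D).
have l0 : 0 < l by rewrite lt_min divr_gt0// andbT; lra.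
have l1 : l <= 2^-1 by rewrite ge_min lexx.
have lD : l * D <= e by rewrite -ler_pdivlMr// ge_min lexx orbT.
have l'0 : 0 < 1 - l by lra.
have lp : 0 < (1 - l) `^ p by rewrite powR_gt0.
have lp1 : (1 - l) `^ p < 1.
  have := gt0_ltr_powR p0 (ltW l'0 : 1 - l \in Num.nneg) (ler01 : 1 \in Num.nneg).
  by rewrite powR1; apply; lra.
pose e' := Num.min cs (cs * ((1 - l) `^ p)^-1 - cs).
have e'0 : 0 < e'.
  by rewrite lt_min cspos/= subr_gt0 ltr_pMr// invf_gt1.
have [pi0 [h1 h2 h3]] := app _ e'0.
have c1 : (cost pi0 <= (2 * cs)%:E)%E.
  by rewrite (le_trans h3)// lee_fin mulr2n mulrDl mul1r lerD2l ge_min lexx.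
have c2 : (cost pi0 <= (cs * ((1 - l) `^ p)^-1)%:E)%E.
  by rewrite (le_trans h3)// lee_fin -lerBrDl ge_min lexx orbT.
pose Z (w : bX2) : bX2 := (w.1, ((w.2 : X) + l *: ((w.1 : X) - (w.2 : X)) : X)).
have ml : measurable_fun setT (fun y : bX => (l *: (y : X) : bX)).
  by apply: continuous_borel => y; apply: cvgZr; exact: cvg_id.
have mZ : measurable_fun setT Z.
  apply: measurable_fun_pair => //; apply: measurable_add2 => //.
  by apply: (measurableT_comp ml); exact: measurable_sub2.
have [pi [_ hpi]] := pushforward_probability pi0 Z mZ.
exists pi; split.
- move=> g mg g0; rewrite (hpi (fun w => g w.1))//; last exact: measurableT_comp.
  exact: h1.
- rewrite /cost (hpi (fun w => (`|(w.1 : X) - (w.2 : X)| `^ p)%:E)); first last.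
  + by move=> w; rewrite lee_fin powR_ge0.
  + exact: (measurable_pow p _ measurable_dist).
  rewrite (eq_integral (fun w : bX2 => ((1 - l) `^ p * `|(w.1 : X) - (w.2 : X)| `^ p)%:E)).
    rewrite ipow ?(ltW lp)//.
    apply: (le_trans (lee_wpmul2l _ c2)); first by rewrite lee_fin ltW.
    by rewrite -EFinM lee_fin mulrCA divff ?gt_eqF// mulr1.
  move=> w _ /=; rewrite -powRM ?(ltW l'0)//; congr (_ `^ _)%:E.
  rewrite opprD addrA -{1}(scale1r (w.1 - w.2)) -scalerBl normrZ gtr0_norm//.
- rewrite (image_law_Rint _ _ _ _ mZ hpi b2)/=.
  rewrite (image_law_Rint _ _ _ _ measurable_snd h2 bf).
  apply: (@le_trans _ _ (\int[pi0]_w f ((Z w).2 : X) + (L * l + L * l * (2 * cs)))).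
    apply: (Rint_le_add _ _ _ (fun w : bX2 => L * l * `|(w.1 : X) - (w.2 : X)| `^ p)) => //.
    + exact: (bmeas_comp _ _ _ _ _ _ mZ b2).
    + by move=> w; rewrite !mulr_ge0 ?powR_ge0// ltW.
    + rewrite ipow ?mulr_ge0 ?(ltW l0)// [leRHS]EFinM.
      by rewrite lee_wpmul2l// lee_fin mulr_ge0// ltW.
    + move=> w; rewrite -lerBlDl; apply: (le_trans (ler_norm _)).
      apply: (le_trans (fL _ _)); rewrite /Z/= opprD addrA subrr add0r normrN normrZ gtr0_norm//.
      rewrite mulrA -[X in _ <= X + _]mulr1 -mulrDr.
      apply: ler_wpM2l; first by apply: mulr_ge0 => //; exact: ltW.
      by apply: le_one_pow.
  rewrite lerD2l (le_trans _ lD)// /D.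
  have -> : L * l + L * l * (2 * cs) = l * (L * (1 + 2 * cs)) by ring.
  rewrite ler_wpM2l ?(ltW l0)// ler_wpM2r ?lerDl//; lra.
Qed.

End wasserstein.

(** * Laws seen through K *)
Section laws_through_K.
Context {R : realType} {X : completeNormedModType R}.
Context (K : {linear X -> X}) (K_contr : forall x : X, `|K x| <= `|x|).
Notation bX := (borel X).

Lemma K_continuous : continuous K.
Proof.
move=> x; apply/cvgrPdist_lt => e e0.
apply/nbhs_ballP; exists e => //= y; rewrite -ball_normE /ball_ /= => xy.
by rewrite -linearB (le_lt_trans (K_contr _)).
Qed.

Lemma LipKb_bound (u : X -> R) : (supnorm u < +oo)%E ->
  exists M, forall x, `|u x| <= M.
Proof.
move=> ub.
have s0 : (0 <= supnorm u)%E.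
  by apply: le_ereal_sup_tmp; exists `|u 0|%:E; [exists 0|rewrite lee_fin].
have sf : supnorm u \is a fin_num by rewrite ge0_fin_numE.
exists (fine (supnorm u)) => x; rewrite -lee_fin fineK//.
by apply: ereal_sup_ubound; exists x.
Qed.

Lemma LipKbE (u : X -> R) : LipKb K u <-> exists L M : R, [/\ 0 <= L,
  forall x, `|u x| <= M & forall x y, `|u x - u y| <= L * `|K (x - y)|].
Proof.
split=> [[[L L0 uL] /LipKb_bound[M uM]]|[L [M [L0 uM uL]]]]; first by exists L, M.
split; first by exists L.
apply: (@le_lt_trans _ _ M%:E); last exact: ltry.
by apply: ge_ereal_sup => _ [x _ <-]; rewrite lee_fin.
Qed.

(** The point [1] keeps the infimum below meaningful and bounded when [U] is the
    whole space. *)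
Definition dists_compl (U : set X) (y : X) : set R :=
  [set `|y - z| | z in ~` U] `|` [set 1].

Definition dist_compl (U : set X) (y : X) : R := inf (dists_compl U y).

Lemma dist_compl_lb (U : set X) (y : X) (z : R) : dists_compl U y z -> 0 <= z.
Proof. by move=> [[t _ <-]|->]. Qed.

Lemma dist_compl_inf (U : set X) (y : X) (z : R) : dists_compl U y z ->
  dist_compl U y <= z.
Proof. by move=> yz; apply: ge_inf => //; exists 0 => t; exact: dist_compl_lb. Qed.

Lemma dist_compl_ge (U : set X) (y : X) (e : R) :
  (forall z, dists_compl U y z -> e <= z) ->
  e <= dist_compl U y.
Proof. by move=> H; apply: lb_le_inf => //; exists 1; right. Qed.

Lemma dist_compl_ge0 U y : 0 <= dist_compl U y.
Proof. by apply: dist_compl_ge => z; exact: dist_compl_lb. Qed.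

Lemma dist_compl_lip U y y' : dist_compl U y - dist_compl U y' <= `|y - y'|.
Proof.
rewrite lerBlDr -lerBlDl; apply: dist_compl_ge => e [[z Uz <-]|->].
  rewrite lerBlDl (le_trans (dist_compl_inf U y _ (or_introl (ex_intro2 _ _ z Uz erefl))))//.
  exact: ler_distD.
by rewrite lerBlDl (le_trans (dist_compl_inf U y 1 (or_intror erefl)))// lerDr.
Qed.

Lemma dist_compl_gt0 U y : open U -> U y -> 0 < dist_compl U y.
Proof.
move=> oU Uy; have /nbhs_ballP[e /= e0 eU] : nbhs y U by exact: open_nbhs_nbhs.
apply: (@lt_le_trans _ _ (Num.min e 1)); first by rewrite lt_min e0 ltr01.
apply: dist_compl_ge => _ [[z Uz <-]|->]; last by rewrite ge_min lexx orbT.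
rewrite ge_min leNgt; apply/orP; left; apply/negP => yz.
by apply: Uz; apply: eU; rewrite -ball_normE.
Qed.

Lemma dist_compl_eq0 U y : ~ U y -> dist_compl U y = 0.
Proof.
move=> Uy; apply/le_anti; rewrite dist_compl_ge0 andbT.
by apply: dist_compl_inf; left; exists y => //; rewrite subrr normr0.
Qed.

Lemma min1_lip (a b : R) : `|Num.min 1 a - Num.min 1 b| <= `|a - b|.
Proof.
rewrite /Num.min; case: ifPn => h1; case: ifPn => h2.
- by rewrite subrr normr0.
- by rewrite ler_norml; have := ler_norm (a - b); lra.
- by rewrite ler_norml; have := ler_norm (b - a); rewrite distrC; lra.
- by [].
Qed.

(** A function of [K x] that is Lipschitz and bounded belongs to [LipKb], and
    indicators of open sets are increasing limits of Lipschitz functions. Nothing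
    beyond the image under [K] is determined, since [K] may have a kernel. *)
Lemma K_law_unique (m1 m2 : probability bX R) :
  (forall v : X -> R, LipKb K v -> (forall x, 0 <= v x) ->
     (\int[m1]_x (v (x : X))%:E = \int[m2]_x (v (x : X))%:E)%E) ->
  forall D : set bX, measurable D -> m1 (K @^-1` D) = m2 (K @^-1` D).
Proof.
move=> H.
have mK : measurable_fun setT (K : bX -> bX) by exact: continuous_borel K_continuous.
pose n1 : {measure set bX -> \bar R} := giry_map mK m1.
pose n2 : {measure set bX -> \bar R} := giry_map mK m2.
move=> D mD.
rewrite -[LHS]/(n1 D) -[RHS]/(n2 D).
apply: (@g_sigma_algebra_measure_unique _ R bX (@open X) _ (fun=> setT) _ _ n1 n2) => //.
- by move=> U oU; exact: borel_open.
- by move=> _; exact: openT.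
- by rewrite bigcup_const.
- by move=> A B; exact: openI.
- move=> U oU.
  pose v (k : nat) (x : X) := Num.min 1 (k%:R * dist_compl U (K x)).
  have v0 k x : 0 <= v k x by rewrite le_min ler01 mulr_ge0// dist_compl_ge0.
  have vK k : LipKb K (v k).
    apply/LipKbE; exists k%:R, 1; split=> // [x|x y].
      by rewrite ger0_norm// ge_min lexx.
    apply: (le_trans (min1_lip _ _)); rewrite -mulrBr normrM ger0_norm// ler_wpM2l//.
    rewrite linearB ler_norml dist_compl_lip andbT lerNl opprB distrC.
    exact: dist_compl_lip.
  have mv k : measurable_fun setT (fun x : bX => (v k (x : X))%:E).
    have [L [M [L0 vM vL]]] := (LipKbE _).1 (vK k).
    apply/measurable_EFinP.
    have /= := @lip_bmeas R X (v k) L M L0 vM _.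
    case=> [x y|//]; apply: le_trans (vL x y) _; exact: ler_wpM2l.
  have cvm (m : probability bX R) :
     (\int[m]_x (v k (x : X))%:E)%E @[k --> \oo] --> m (K @^-1` U).
    have mKU : measurable (K @^-1` U : set bX).
      by have := mK measurableT _ (borel_open U oU); rewrite setTI.
    rewrite -[X in m X]setIT -(integral_indic m measurableT)//.
    have -> : (\int[m]_x (\1_(K @^-1` U) x)%:E =
       \int[m]_x limn (fun k => (v k (x : X))%:E))%E.
      apply: eq_integral => x _; apply/esym/cvg_lim => //.
      have [Ux|Ux] := pselect (U (K x)); last first.
        rewrite indicE memNset//; apply: cvg_near_cst; apply: nearW => k.
        by rewrite /v dist_compl_eq0// mulr0 min_r ?ler01.
      rewrite indicE mem_set//.
      have d0 := dist_compl_gt0 U (K x) oU Ux.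
      apply: cvg_near_cst.
      near=> k; rewrite /v min_l//.
      rewrite -ler_pdivrMr// div1r; near: k; exact: nbhs_infty_ger.
    apply: cvg_monotone_convergence => //.
    + by move=> k x _; rewrite lee_fin.
    + move=> x _ a b ab; rewrite lee_fin /v le_min ge_min lexx/=.
      by rewrite ge_min ler_wpM2r ?orbT// ?ler_nat// dist_compl_ge0.
  apply: (cvg_unique _ (cvm m1)) => //=.
  rewrite (_ : (fun k => _) = fun k => \int[m2]_x (v k (x : X))%:E)%E; first exact: cvm.
  by apply/funext => k; exact: H.
- move=> _; rewrite /n1 /giry_map/= /pushforward preimage_setT.
  by rewrite (le_lt_trans (probability_le1 _ _))// ltry.
Unshelve. all: by end_near. Qed.

End laws_through_K.

(** * Changing the first marginal of a coupling *)
Section first_marginal.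
Context {R : realType} {X : completeNormedModType R} (sepX : separable X).
Context (p : R) (p1 : 1 < p).
Context (K : {linear X -> X}) (K_contr : forall x : X, `|K x| <= `|x|).
Notation bX := (borel X).
Notation bX2 := (borel X * borel X)%type.

(** The law of [mu] given [E]. For a nonempty null set any law carried by it will do:
    it is never drawn with positive probability, but it must still sit on [E]. *)
Lemma conditional_law d (T : measurableType d) (mu : probability T R) (E : set T) :
  measurable E -> exists Q : probability T R,
    (E !=set0 -> Q E = 1%E) /\
    (forall A, measurable A -> (Q A * mu E = mu (A `&` E))%E).
Proof.
move=> mE.
have [mu0|mu0] := eqVneq (mu E) 0%E.
  have mu0' A : measurable A -> mu (A `&` E) = 0%E.
    move=> mA; apply/eqP; rewrite eq_le measure_ge0 andbT -mu0.
    by apply: le_measure; rewrite ?inE; [exact: measurableI|exact: mE|exact: subIsetr].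
  have [->|/set0P[x Ex]] := eqVneq E set0.
    exists mu; split; first by move=> [].
    by move=> A mA; rewrite setI0 measure0 mule0.
  exists (dirac x : probability T R); split=> [_|A mA].
    by rewrite -[LHS]/(@dirac _ T x R E) diracE mem_set.
  by rewrite mu0 mule0 mu0'.
pose Q : probability T R := mnormalize (mrestr mu mE) mu.
have QE A : Q A = (mu (A `&` E) * (fine (mu E))^-1%:E)%E.
  rewrite -[LHS]/((if (mu (setT `&` E) == 0%E) || (mu (setT `&` E) == +oo%E)
    then fun U => mu U
    else fun U => (mu (U `&` E) * (fine (mu (setT `&` E)))^-1%:E)%E) A).
  have muy : mu E != +oo%E.
    by rewrite -ltey (le_lt_trans (probability_le1 _ _))// ltry.
  by rewrite setTI (negbTE mu0) (negbTE muy).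
have mf : mu E \is a fin_num by exact: fin_num_measure.
have f0 : fine (mu E) != 0 by rewrite fine_eq0.
exists Q; split=> [_|A mA]; rewrite QE.
  by rewrite setIid -{1}(fineK mf) -EFinM divff.
by rewrite -muleA -{2}(fineK mf) -EFinM mulVf// mule1.
Qed.

(** Cut the space into small cells according to the value of [K]. Given a pair
    [(y, z)] of law [Pi], draw [y'] from [mu] conditioned on the cell of [y] and keep
    the displacement: the new pair is [(y', y' + (z - y))]. Cells have the same mass
    under [m] and [mu], so [y'] has law [mu]; the distance is unchanged; and the
    second component moves by [y' - y], which [K] sends close to [0]. *)
Lemma replace_first_marginal (mu m : probability bX R) (Pi : probability bX2 R)
    (f : X -> R) (L M e : R) :
  image_law Pi fst m ->
  (forall D : set bX, measurable D -> m (K @^-1` D) = mu (K @^-1` D)) ->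
  0 <= L -> (forall x, `|f x| <= M) -> (forall x y, `|f x - f y| <= L * `|K (x - y)|) ->
  0 < e ->
  exists Pi' : probability bX2 R, [/\ image_law Pi' fst mu, cost p Pi' = cost p Pi &
    \int[Pi]_w f (w.2 : X) <= \int[Pi']_w f (w.2 : X) + e].
Proof.
move=> hPi KD L0 fM fL e0.
pose delta := e / (2 * (L + 1)).
have delta0 : 0 < delta by rewrite divr_gt0// mulr_gt0// ltr_wpDl.
have [d [n [mn nd]]] := borel_cells sepX delta delta0.
pose N x := n (K x).
have mK : measurable_fun setT (K : bX -> bX) by apply: continuous_borel; exact: K_continuous.
have mN i : measurable (N @^-1` [set i] : set bX).
  by have := mK measurableT _ (mn i); rewrite setTI.
have /choice[Q hQ] : forall i, exists Q : probability bX R,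
    ((N @^-1` [set i] : set bX) !=set0 -> Q (N @^-1` [set i]) = 1%E) /\
    (forall A, measurable A -> (Q A * mu (N @^-1` [set i]) = mu (A `&` N @^-1` [set i]))%E).
  by move=> i; exact: conditional_law.
(* [w.1] is the given pair and [w.2] the resampled first component. *)
pose F (w : bX2 * bX) : bX2 := (w.2, ((w.2 : X) + ((w.1.2 : X) - (w.1.1 : X)) : X)).
have mF : measurable_fun setT F.
  apply: measurable_fun_pair => //; apply: measurable_add2 => //.
  apply: measurable_sub2 => //.
    by apply: (measurableT_comp measurable_snd); exact: measurable_fst.
  by apply: (measurableT_comp measurable_fst); exact: measurable_fst.
have mN1 i : measurable ((fun w : bX2 => N w.1) @^-1` [set i]).
  by have := @measurable_fst _ _ bX bX measurableT _ (mN i); rewrite setTI.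
have [Pi' hPi'] := mixture Pi (fun w : bX2 => N w.1) Q F mN1 mF.
exists Pi'; split.
- apply: law_of_sets => // A mA.
  have mA1 : measurable_fun setT (fun y : bX => (\1_A y)%:E : \bar R).
    exact/measurable_EFinP.
  have A0 y : (0 <= (\1_A y)%:E :> \bar R)%E by rewrite lee_fin.
  have mfA : measurable (fst @^-1` A : set bX2).
    by have := @measurable_fst _ _ bX bX measurableT _ mA; rewrite setTI.
  have QA i : (\int[Q i]_y (\1_A y)%:E = Q i A)%E.
    by rewrite integral_indic// setIT.
  pose G (y : bX) := (Q (n y) A)%E.
  have mG : measurable_fun setT G.
    exact: (@measurable_fun_nat _ bX _ (\bar R) n (fun i _ => Q i A) mn
      (fun i => measurable_cst _)).
  have mGN : measurable_fun setT (fun x : bX => Q (N x) A).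
    exact: (measurableT_comp mG mK).
  have -> : (Pi' (fst @^-1` A) = \int[m]_x Q (N x) A)%E.
    rewrite -[X in Pi' X]setIT -(integral_indic Pi' measurableT)//.
    have [|_ ->//] := hPi' (fun w => (\1_A w.1)%:E) _ (fun w => A0 _).
      exact: (measurableT_comp mA1 measurable_fst).
    rewrite (hPi (fun x => Q (N x) A)) => //.
    by apply: eq_integral => w _; exact: QA.
  have -> : (\int[m]_x Q (N x) A = \int[mu]_x Q (N x) A)%E.
    have [q1 [q1E q1I]] := pushforward_probability m (K : bX -> bX) mK.
    have [q2 [q2E q2I]] := pushforward_probability mu (K : bX -> bX) mK.
    rewrite -(q1I G)// -(q2I G)//; apply: eq_measure_integral => D mD _.
    exact: (etrans (q1E D) (etrans (KD D mD) (esym (q2E D)))).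
  have tE : trivIset setT (fun i => N @^-1` [set i] : set bX).
    by apply/trivIsetP => i j _ _ /eqP ij; rewrite -subset0 => x [/= -> /ij].
  have UE : \bigcup_i (N @^-1` [set i]) = setT :> set bX.
    by rewrite -subTset => x _; exists (N x).
  have dec g : measurable_fun setT g -> (forall x, 0 <= g x)%E ->
      (\int[mu]_x g x = \sum_(0 <= i <oo) \int[mu]_(x in N @^-1` [set i]) g x)%E.
    by move=> mg g0; rewrite -ge0_integral_bigcup ?UE.
  rewrite dec// -[in RHS](setIT A) -(integral_indic mu measurableT)// dec//.
  apply: eq_eseriesr => i _; rewrite (integral_indic mu (mN i))//.
  rewrite -[RHS]/(mu (A `&` N @^-1` [set i])) -(hQ i).2//.
  rewrite -(integral_cst mu (mN i))//; apply: eq_integral => x; rewrite inE /= => Nx.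
  by rewrite Nx.
- have mc := measurable_pow p _ (measurable_dist sepX).
  have c0 (w : bX2) : (0 <= (`|(w.1 : X) - (w.2 : X)| `^ p)%:E)%E by rewrite lee_fin powR_ge0.
  rewrite /cost; have [_ ->] := hPi' _ mc c0.
  apply: eq_integral => w _; rewrite /F/=.
  rewrite -[RHS](probability_integral_cst (Q (N w.1))); apply: eq_integral => y _ /=.
  by rewrite opprD addrA subrr add0r opprB.
- have fL' x y : `|f x - f y| <= L * `|x - y|.
    by rewrite (le_trans (fL _ _))// ler_wpM2l.
  have bf := lip_bmeas _ _ _ L0 fM fL'.
  have b2 : bmeas (fun w : bX2 => f (w.2 : X)) by exact: bmeas_comp.
  have [bI ->] := mixture_law_Rint _ _ _ _ _ _ mF hPi' b2.
  have be : bmeas (fun _ : bX2 => e) by exact: bmeas_cst.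
  rewrite -[X in _ <= _ + X](Rint_cst Pi e) -RintD//.
  apply: le_Rint => //; first exact: bmeasD.
  move=> w; rewrite -(Rint_cst (Q (N w.1)) (f w.2)) -[X in _ <= _ + X]addr0.
  pose E : set bX := N @^-1` [set N w.1].
  have mE : measurable E by exact: mN.
  have M0 : 0 <= M by apply: le_trans (fM 0).
  (* Off the cell, a null set for the conditional law, the crude bound [2 * M]. *)
  apply: (Rint_le_add _ _ _ (fun y : bX => 2 * M * \1_(~` E) y)).
  - exact: bmeas_cst.
  - have mFw : measurable_fun setT (fun y : bX => F (w, y)) by apply: measurableT_comp.
    exact: (bmeas_comp _ _ _ _ (fun y : bX => F (w, y)) _ mFw b2).
  - apply: measurable_funM => //; apply: measurable_indic; exact: measurableC.
  - by move=> y; rewrite !mulr_ge0.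
  - under eq_integral do rewrite EFinM.
    have mI : measurable_fun setT (fun y : bX => (\1_(~` E) y : R)%:E).
      by apply/measurable_EFinP; apply: measurable_indic; exact: measurableC.
    have I0 (y : bX) : setT y -> (0 <= (\1_(~` E) y : R)%:E)%E.
      by move=> _; rewrite lee_fin.
    have M20 : 0 <= 2 * M by rewrite mulr_ge0.
    rewrite ge0_integralZl_EFin//.
    have QE0 : (Q (N w.1) (~` E) = 0)%E.
      by rewrite probability_setC// (hQ _).1 ?subee//; exists w.1.
    rewrite integral_indic//; last exact: measurableC.
    by rewrite setIT [X in (_ * X)%E](QE0) mule0.
  - move=> y; rewrite -lerBlDl; apply: (le_trans (ler_norm _)).
    have [Ey|nEy] := pselect (E y).
      rewrite indicE memNset/= ?mulr0 ?addr0; last by move=> /(_ Ey).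
      apply: (le_trans (fL _ _)).
      have -> : (w.2 : X) - ((y : X) + ((w.2 : X) - (w.1 : X))) = (w.1 : X) - (y : X).
        by rewrite opprD opprB addrCA subrKC addrC.
      have Kd : `|K ((w.1 : X) - (y : X))| <= 2 * delta.
        rewrite linearB (le_trans (ler_distD (d (N w.1)) _ _))//.
        rewrite mulr2n mulrDl mul1r; apply: lerD; apply: ltW; first exact: nd.
        by rewrite distrC -Ey; exact: nd.
      apply: (le_trans (ler_wpM2l L0 Kd)).
      rewrite /delta mulrA mulrA ler_pdivrMr ?mulr_gt0 ?ltr_wpDl//.
      have -> : e * (2 * (L + 1)) = L * 2 * e + 2 * e by ring.
      by rewrite mulrA lerDl mulr_ge0// ltW.
    rewrite indicE mem_set//= mulr1 (le_trans (ler_normB _ _))//.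
    have := fM (w.2 : X); have := fM ((y : X) + ((w.2 : X) - (w.1 : X))); lra.
Qed.

End first_marginal.

(** * Functions of a countable-valued map *)
Section countable_valued.
Context {d} {T : measurableType d} {R : realType} (P : probability T R).
Context (n : T -> nat) (mn : forall i, measurable (n @^-1` [set i])).

Definition mass (i : nat) : R := fine (P (n @^-1` [set i])).

Lemma mass_ge0 i : 0 <= mass i.
Proof. exact: fine_ge0. Qed.

Lemma measurable_comp_nat d' (T' : measurableType d') (g : nat -> T') :
  measurable_fun setT (fun w => g (n w)).
Proof.
exact: (@measurable_fun_nat _ T _ T' n (fun i _ => g i) mn (fun i => measurable_cst _)).
Qed.

Lemma integral_comp_nat (N : nat) (g : nat -> R) : (forall i, 0 <= g i) ->
  (forall i, (N <= i)%N -> g i = 0) ->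
  (\int[P]_w (g (n w))%:E = (\sum_(0 <= i < N) mass i * g i)%:E)%E.
Proof.
move=> g0 gN.
transitivity (\int[P]_w (\sum_(0 <= i < N) (g i * \1_(n @^-1` [set i]) w)%:E))%E.
  apply: eq_integral => w _; rewrite sumEFin; congr EFin.
  have E i : \1_(n @^-1` [set i]) w = (n w == i)%:R :> R.
    rewrite indicE; case: (eqVneq (n w) i) => h; first by rewrite mem_set.
    by rewrite memNset//= => /eqP; apply/negP.
  under eq_bigr do rewrite E.
  have [nN|Nn] := ltnP (n w) N.
    rewrite (bigD1_seq (n w)) ?iota_uniq ?mem_index_iota//= eqxx mulr1 big1 ?addr0//.
    by move=> i /negbTE; rewrite eq_sym => ->; rewrite mulr0.
  rewrite (gN _ Nn) big_nat big1// => i /andP[_ iN].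
  by rewrite gtn_eqF ?mulr0// (leq_trans iN).
rewrite ge0_integral_sum//; first last.
- by move=> i w _; rewrite lee_fin mulr_ge0.
- by move=> i; apply/measurable_EFinP/measurable_funM => //; exact: measurable_indic.
rewrite -sumEFin; apply: eq_bigr => i _.
under eq_integral do rewrite EFinM.
rewrite ge0_integralZl_EFin//; first last.
- by apply/measurable_EFinP; exact: measurable_indic.
rewrite integral_indic// setIT EFinM muleC /mass fineK// ?fin_num_measure//.
Qed.

Lemma mass_le1 N : \sum_(0 <= i < N) mass i <= 1.
Proof.
pose g (i : nat) : R := (i < N)%:R.
have := @integral_comp_nat N g (fun i => ler0n _ _).
have -> : \sum_(0 <= i < N) mass i * g i = \sum_(0 <= i < N) mass i.
  rewrite !big_nat; apply: eq_bigr => i /andP[_ iN].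
  by rewrite /g iN mulr1.
move=> /(_ _)H; rewrite -lee_fin -H => [|i Ni]; last by rewrite /g ltnNge Ni.
rewrite -(probability_integral_cst P 1%E); apply: ge0_le_integral => //.
- by move=> w _; rewrite lee_fin ler0n.
- by apply/measurable_EFinP; exact: (@measurable_comp_nat _ R g).
- by move=> w _; rewrite lee_fin /g; case: (_ < _)%N; rewrite ?ler01.
Qed.

Lemma measurable_tail N : measurable [set w | (N <= n w)%N].
Proof.
have -> : [set w | (N <= n w)%N] = ~` \bigcup_(i < N) n @^-1` [set i].
  apply/seteqP; split => w /=.
    by move=> Nn [i /= iN ni]; move: iN; rewrite -ni ltnNge Nn.
  by move=> H; rewrite leqNgt; apply/negP => nN; apply: H; exists (n w).
by apply: measurableC; apply: bigcup_measurable.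
Qed.

(** Allows a countable choice of couplings to be cut down to a finite one. *)
Lemma tail_small (e : R) : 0 < e -> exists N,
  (P [set w | (N <= n w)%N] <= e%:E)%E.
Proof.
move=> e0; pose F N := [set w | (N <= n w)%N].
have mF N : measurable (F N) by exact: measurable_tail.
have cv : P (F k) @[k --> \oo] --> P (\bigcap_k F k).
  apply: nonincreasing_cvg_mu => //.
  - by rewrite (le_lt_trans (probability_le1 _ _))// ltry.
  - exact: bigcap_measurable.
  - by move=> a b ab; apply/subsetPset => w /=; exact: leq_trans.
have F0 : \bigcap_k F k = set0.
  by rewrite -subset0 => w /(_ (n w).+1 I); rewrite /F /= ltnn.
rewrite F0 measure0 in cv.
have /fine_cvgP[_ cv'] := cv.
have [N _ H] := cvgr_lt _ cv' _ e0.
exists N; have := H N (leqnn _); rewrite /= => /ltW.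
by rewrite -lee_fin fineK// fin_num_measure.
Qed.

End countable_valued.

(** * Concatenation of couplings *)
Section concatenation.
Context {R : realType} {X : completeNormedModType R} (sepX : separable X).
Context (p : R) (p1 : 1 < p).
Notation bX := (borel X).
Notation bX2 := (borel X * borel X)%type.

Context (psi : X -> X) (k : R) (k0 : 0 <= k) (psi_cont : continuous psi).
Context (psi_lip : forall x1 x2, `|psi x1 - psi x2| <= k * `|x1 - x2|).
Context (m : probability bX R) (b a : X).
Context (Pi0 : probability bX2 R) (n : X -> nat) (Q : nat -> probability bX2 R).
Context (mn : forall i, measurable (n @^-1` [set i] : set bX)).
Context (Qm : forall i, image_law (Q i) fst m).

(** Displacement, seen from [a], of a path that leaves [b], jumps by [w], follows
    the flow [psi] and jumps by [w']. *)
Definition step (w w' : X) : X := psi (b + w) + w' - a.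

Definition step2 (z : bX2 * bX2) : bX2 :=
  (step (z.1.1 : X) (z.2.1 : X), step (z.1.2 : X) (z.2.2 : X)).

Lemma measurable_step d (T : measurableType d) (f g : T -> bX) :
  measurable_fun setT f -> measurable_fun setT g ->
  measurable_fun setT (fun z => step (f z : X) (g z : X) : bX).
Proof.
move=> mf mg; rewrite /step.
apply: measurable_sub2 => //; apply: measurable_add2 => //.
apply: (measurableT_comp (continuous_borel _ psi_cont)).
exact: measurable_add2.
Qed.

Lemma measurable_step2 : measurable_fun setT step2.
Proof.
have m1 : measurable_fun setT (fst : bX2 * bX2 -> bX2) by exact: measurable_fst.
have m2 : measurable_fun setT (snd : bX2 * bX2 -> bX2) by exact: measurable_snd.
by apply: measurable_fun_pair; apply: measurable_step;
  [exact: (measurableT_comp measurable_fst m1)|exact: (measurableT_comp measurable_fst m2)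
  |exact: (measurableT_comp measurable_snd m1)|exact: (measurableT_comp measurable_snd m2)].
Qed.

Let n' (w : bX2) := n (b + (w.2 : X)).

Lemma measurable_cell i : measurable (n' @^-1` [set i]).
Proof.
have ma : measurable_fun setT (fun w : bX2 => b + (w.2 : X) : bX) by exact: measurable_add2.
by have := ma measurableT _ (mn i); rewrite setTI.
Qed.

Context (Pi : probability bX2 R) (hPi : mixture_law Pi0 n' Q step2 Pi).

(** The second draw has first marginal [m] whatever the cell, so the dependence on
    the cell disappears from the law of the first component. *)
Lemma concat_fst (m0 : probability bX R) (g : bX -> \bar R) : image_law Pi0 fst m0 ->
  measurable_fun setT g -> (forall x, 0 <= g x)%E ->
  (\int[Pi]_w g w.1 = \int[m0]_y \int[m]_y' g (step (y : X) (y' : X) : bX))%E.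
Proof.
move=> hm0 mg g0.
have mg1 : measurable_fun setT (fun w : bX2 => g w.1).
  exact: (measurableT_comp mg measurable_fst).
have [_ ->] := hPi _ mg1 (fun w => g0 _).
rewrite (hm0 (fun y => \int[m]_y' g (step (y : X) (y' : X) : bX))%E); first last.
- by move=> y; apply: integral_ge0.
- have mgs : measurable_fun setT (fun z : bX2 => g (step (z.1 : X) (z.2 : X) : bX)).
    by apply: (measurableT_comp mg); exact: measurable_step.
  exact: (@measurable_fun_fubini_tonelli_F _ _ _ _ _ m _ mgs (fun z => g0 _)).
apply: eq_integral => w _; rewrite (Qm (n' w) (fun y' => g (step (w.1 : X) (y' : X) : bX)))//.
by apply: (measurableT_comp mg); exact: measurable_step.
Qed.

Lemma concat_snd (u : X -> R) : bmeas (u : bX -> R) ->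
  bmeas (fun w : bX2 => \int[Q (n' w)]_w' u (psi (b + (w.2 : X)) + (w'.2 : X))) /\
  \int[Pi]_w u (a + (w.2 : X)) =
  \int[Pi0]_w \int[Q (n' w)]_w' u (psi (b + (w.2 : X)) + (w'.2 : X)).
Proof.
move=> bu.
have b2 : bmeas (fun w : bX2 => u (a + (w.2 : X))).
  apply: (bmeas_comp _ _ _ _ (fun w : bX2 => a + (w.2 : X) : bX) _ _ bu).
  exact: measurable_add2.
have [bI ->] := mixture_law_Rint _ _ _ _ _ _ measurable_step2 hPi b2.
by move: bI; rewrite /step2 /step /=; under eq_fun do under eq_Rintegral do rewrite addrC subrK.
Qed.

Context (N : nat) (A : R) (B : nat -> R) (B0 : forall i, 0 <= B i).
Context (BN : forall i, (N <= i)%N -> B i = 0).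
Context (cA : (cost p Pi0 <= A%:E)%E) (cB : forall i, (cost p (Q i) <= (B i)%:E)%E).

(** The two components of [step2] differ by at most [k] times the first distance plus
    the second one; [powR_split] is applied pointwise. *)
Lemma concat_cost (q : R) : 0 < q < 1 ->
  (cost p Pi <= (q * (q^-1 * k) `^ p * A +
    (1 - q) * ((1 - q)^-1) `^ p * \sum_(0 <= i < N) mass Pi0 n' i * B i)%:E)%E.
Proof.
move=> q01; have /andP[q0 q1] := q01.
set al := q * _; set be := (1 - q) * _.
have al0 : 0 <= al by rewrite mulr_ge0 ?powR_ge0// ltW.
have be0 : 0 <= be by rewrite mulr_ge0 ?powR_ge0// subr_ge0 ltW.
have md := measurable_dist sepX.
have mc := measurable_pow p _ md.
have c0 (w : bX2) : (0 <= (`|(w.1 : X) - (w.2 : X)| `^ p)%:E)%E by rewrite lee_fin powR_ge0.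
rewrite /cost; have [mI ->] := hPi _ mc c0.
have mB : measurable_fun setT (fun w : bX2 => (be * B (n' w))%:E).
  apply/measurable_EFinP.
  exact: (@measurable_comp_nat _ _ n' measurable_cell _ R (fun i => be * B i)).
apply: (@le_trans _ _ (\int[Pi0]_w ((al * `|(w.1 : X) - (w.2 : X)| `^ p)%:E +
    (be * B (n' w))%:E))%E).
  apply: ge0_le_integral => //.
  - by move=> w _; apply: integral_ge0 => w' _; rewrite lee_fin powR_ge0.
  - apply: emeasurable_funD => //; apply/measurable_EFinP.
    exact: (@measurable_Zpow _ _ R p al (fun w : bX2 => `|(w.1 : X) - (w.2 : X)|)).
  move=> w _.
  have := @integral_powR_split _ _ _ (Q (n' w)) p p1
    (fun _ => `|(w.1 : X) - (w.2 : X)|) (fun w' : bX2 => `|(w'.1 : X) - (w'.2 : X)|)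
    (fun w' : bX2 => `|((step2 (w, w')).1 : X) - ((step2 (w, w')).2 : X)|) k q
    (measurable_cst _) md _ _ k0 q01.
  rewrite -/al -/be probability_integral_cst => H; apply: le_trans (H _ _) _.
  - apply: (measurableT_comp md).
    by apply: measurableT_comp => //; exact: measurable_step2.
  - move=> w'; split=> //; rewrite normr_ge0 /step2 /step /=.
    rewrite opprB addrA subrK opprD addrACA (le_trans (ler_normD _ _))// lerD2r.
    rewrite (le_trans (psi_lip _ _))// opprD addrACA subrr add0r//.
  - apply: leeD; first by rewrite -EFinM.
    by rewrite [leRHS]EFinM; apply: lee_wpmul2l; rewrite ?lee_fin//; exact: cB.
rewrite ge0_integralD//; first last.
- by move=> w _; rewrite lee_fin mulr_ge0.
- apply/measurable_EFinP.
  exact: (@measurable_Zpow _ _ R p al (fun w : bX2 => `|(w.1 : X) - (w.2 : X)|)).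
- by move=> w _; rewrite lee_fin mulr_ge0// powR_ge0.
rewrite (@integral_powRZl _ _ _ Pi0 p al (fun w : bX2 => `|(w.1 : X) - (w.2 : X)|))//.
rewrite (@integral_comp_nat _ _ _ Pi0 n' measurable_cell N (fun i => be * B i)); first last.
- by move=> i Ni; rewrite BN// mulr0.
- by move=> i; rewrite mulr_ge0.
rewrite EFinD; apply: leeD.
  by rewrite [leRHS]EFinM; apply: lee_wpmul2l; rewrite ?lee_fin.
by rewrite mulr_sumr lee_fin; under eq_bigr do rewrite mulrCA.
Qed.

End concatenation.

(** * The one-step operator *)
Section operator.
Context {R : realType} {X : completeNormedModType R} (sepX : separable X).
Context (K : {linear X -> X}) (K_contr : forall x : X, `|K x| <= `|x|).
Context (p : R) (p1 : 1 < p).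
Notation bX := (borel X).
Notation bX2 := (borel X * borel X)%type.
Context (mu : R -> probability bX R) (mu_Pp : forall t : R, 0 <= t -> Pp p (mu t)).
Context (psi : R -> X -> X) (c : R).
Context (phi : R -> \bar R) (pen : penalisation p phi).

Notation I t u := (penop p c phi psi mu t (EFin \o u)).
Notation Phi := (Phi p c phi).

Lemma bmeas_add (u : X -> R) (a : X) : bmeas (u : bX -> R) ->
  bmeas (fun z : bX => u (a + (z : X))).
Proof.
move=> bu; apply: (bmeas_comp _ _ _ _ (fun z : bX => a + (z : X) : bX) _ _ bu).
by apply: measurable_add2 => //; exact: measurable_cst.
Qed.

Lemma bmeas_add_snd (u : X -> R) (a : X) : bmeas (u : bX -> R) ->
  bmeas (fun w : bX2 => u (a + (w.2 : X))).
Proof.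
move=> bu; exact: (bmeas_comp _ _ _ _ _ _ measurable_snd (bmeas_add u a bu)).
Qed.

(** The second marginal of any coupling of [mu t] with finite cost is a competitor in
    the supremum, at a transport cost not exceeding that of the coupling. *)
Lemma penop_ge (t C q : R) (u : X -> R) (x : X) (pi : probability bX2 R) :
  0 <= t -> bmeas (u : bX -> R) -> image_law pi fst (mu t) ->
  (cost p pi <= C%:E)%E -> (Phi t C <= q%:E)%E ->
  ((\int[pi]_w u (psi t x + (w.2 : X)) - q)%:E <= I t u x)%E.
Proof.
move=> t0 bu h1 hC hq.
have [nu [_ h2]] := pushforward_probability pi (snd : bX2 -> bX) measurable_snd.
have nuP : Pp p nu.
  have fm : (moment p (mu t) <= (fine (moment p (mu t)))%:E)%E.
    rewrite fineK// ge0_fin_numE; first exact: mu_Pp.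
    by apply: integral_ge0 => y _; rewrite lee_fin powR_ge0.
  exact: le_lt_trans (moment_le_cost sepX p p1 _ _ _ _ _ h1 h2 fm hC) (ltry _).
have [cs [cs0 Wcs _ csle]] := Wp_spec sepX p p1 _ _ (mu_Pp _ t0) nuP.
apply: le_ereal_sup_tmp; eexists; first by exists nu.
have bun := bmeas_add u (psi t x) bu.
rewrite Wcs -/(Phi t cs) bmeas_EFin//.
rewrite (image_law_Rint _ _ _ _ measurable_snd h2 bun) EFinB.
apply: leeB => //; apply: le_trans hq; apply: Phi_mono => //.
rewrite -lee_fin; exact: le_trans (csle _ h1 h2) hC.
Qed.

Lemma penop_le (t M : R) (u : X -> R) (x : X) : 0 <= t ->
  bmeas (u : bX -> R) -> (forall x, `|u x| <= M) -> (I t u x <= M%:E)%E.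
Proof.
move=> t0 bu uM; apply: ge_ereal_sup => _ [nu nuP <-].
have [cs [cs0 Wcs _ _]] := Wp_spec sepX p p1 _ _ (mu_Pp _ t0) nuP.
have bun := bmeas_add u (psi t x) bu.
rewrite Wcs -/(Phi t cs) bmeas_EFin//.
have P0 := Phi_ge0 p c phi pen t cs t0.
rewrite -[leRHS]sube0; apply: leeB => //; rewrite lee_fin.
by apply: (le_trans (ler_norm _)); exact: Rint_bound.
Qed.

Lemma penop_bound (t M : R) (u : X -> R) (x : X) : 0 <= t ->
  bmeas (u : bX -> R) -> (forall x, `|u x| <= M) ->
  exists r, I t u x = r%:E /\ `|r| <= M.
Proof.
move=> t0 bu uM; have := penop_le t M u x t0 bu uM.
have [pi [h1 _ h2]] := diag_coupling sepX p p1 (mu t).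
have hC : (cost p pi <= 0%:E)%E by rewrite h2.
have h0 : (Phi t 0 <= 0%:E)%E by rewrite Phi0.
have := penop_ge t 0 0 u x pi t0 bu h1 hC h0; rewrite subr0.
have := Rint_bound pi _ _ (bmeas_add_snd u (psi t x) bu) (fun w => uM _).
rewrite ler_norml => /andP[hM _].
case: (I t u x) => [r| |]; rewrite ?leye_eq ?leeNy_eq//.
rewrite !lee_fin => Ir rM; exists r; split=> //.
by rewrite ler_norml rM andbT (le_trans hM).
Qed.

(** The operator maps bounded functions to bounded functions, so that its value can
    be handled as a real number. *)
Definition Ir t u x : R := fine (I t u x).

Lemma IrE (t : R) (u : X -> R) (x : X) : 0 <= t ->
  bmeas (u : bX -> R) -> I t u x = (Ir t u x)%:E.
Proof.
move=> t0 bu; have [_ [M uM]] := bu.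
by have [r [E _]] := penop_bound t M u x t0 bu uM; rewrite /Ir E.
Qed.

Lemma Ir_bound (t M : R) (u : X -> R) (x : X) : 0 <= t ->
  bmeas (u : bX -> R) -> (forall x, `|u x| <= M) -> `|Ir t u x| <= M.
Proof.
move=> t0 bu uM.
by have [r [E rM]] := penop_bound t M u x t0 bu uM; rewrite /Ir E.
Qed.

(** Conversely a competitor can be replaced by a coupling, by [contract_coupling]. The
    value [v] of the competitor is real, which makes its penalty finite. *)
Lemma near_coupling (t L M e v : R) (f : X -> R) (x : X) (nu : probability bX R) :
  0 <= t -> 0 <= L -> (forall x, `|f x| <= M) ->
  (forall x y, `|f x - f y| <= L * `|x - y|) -> 0 < e -> Pp p nu ->
  (v%:E <= \int[nu]_z (f (psi t x + (z : X)))%:E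
     - phit c phi t (fine (Wp p (mu t) nu)))%E ->
  exists (pi : probability bX2 R) (C q : R),
   [/\ image_law pi fst (mu t), (0 <= C) /\ (cost p pi <= C%:E)%E,
       0 <= q /\ (Phi t C <= q%:E)%E &
       v <= \int[pi]_w f (psi t x + (w.2 : X)) - q + e].
Proof.
move=> t0 L0 fM fL e0 nuP.
have [cs [cs0 Wcs app _]] := Wp_spec sepX p p1 _ _ (mu_Pp _ t0) nuP.
have bf := lip_bmeas _ _ _ L0 fM fL.
rewrite Wcs -/(Phi t cs) bmeas_EFin; last exact: bmeas_add.
have := Phi_ge0 p c phi pen t cs t0.
case E : (Phi t cs) => [q| |]// q0; rewrite -EFinB lee_fin => vq.
have [|pi [h1 h2 h3]] := contract_coupling sepX p p1 (mu t) nu cs L M e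
  (fun z => f (psi t x + z)) cs0 app L0 (fun z => fM _) _ e0.
  by move=> y z; rewrite (le_trans (fL _ _))// opprD addrACA subrr add0r.
exists pi, cs, q; split=> //; first by rewrite E.
by apply: (le_trans vq); rewrite addrAC lerD2r.
Qed.

Lemma near_optimal (t L M e : R) (u : X -> R) (x : X) :
  0 <= t -> 0 <= L -> (forall x, `|u x| <= M) ->
  (forall x y, `|u x - u y| <= L * `|x - y|) -> 0 < e ->
  exists (pi : probability bX2 R) (C q : R),
   [/\ image_law pi fst (mu t), (0 <= C) /\ (cost p pi <= C%:E)%E,
       0 <= q /\ (Phi t C <= q%:E)%E &
       Ir t u x <= \int[pi]_w u (psi t x + (w.2 : X)) - q + e].
Proof.
move=> t0 L0 uM uL e0.
have bu := lip_bmeas _ _ _ L0 uM uL.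
have e2 : 0 < e / 2 by rewrite divr_gt0.
have If : I t u x \is a fin_num by rewrite IrE.
have [_ [nu nuP <-]] := ub_ereal_sup_adherent e2 If.
rewrite -/(I t u x) IrE// -EFinB => /ltW H.
have [pi [C [q [h1 h2 h3 h4]]]] := near_coupling _ _ _ _ _ _ x _ t0 L0 uM uL e2 nuP H.
exists pi, C, q; split=> //.
by move: h4; rewrite lerBlDr -addrA -splitr.
Qed.

Lemma LipK_norm (L : R) (u : X -> R) : 0 <= L ->
  (forall x y, `|u x - u y| <= L * `|K (x - y)|) ->
  forall x y, `|u x - u y| <= L * `|x - y|.
Proof. by move=> L0 uL x y; rewrite (le_trans (uL _ _))// ler_wpM2l. Qed.

Context (psi_lip : forall (t : R) (x1 x2 : X), 0 <= t ->
    `|psi t x1 - psi t x2| <= expR (c * t) * `|x1 - x2|).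
Context (psi_K : forall (t : R) (x : X), 0 <= t -> K (psi t x) = psi t (K x)).

(** [K] commutes with the flow, so a shift of the starting point by [x - y] shifts
    [K] of the endpoint by at most [expR (c * t) * `|K (x - y)|], uniformly in the
    competitor. *)
Lemma Ir_lip (t L M : R) (u : X -> R) : 0 <= t -> 0 <= L ->
  (forall x, `|u x| <= M) ->
  (forall x y, `|u x - u y| <= L * `|K (x - y)|) ->
  forall x y, `|Ir t u x - Ir t u y| <= L * expR (c * t) * `|K (x - y)|.
Proof.
move=> t0 L0 uM uL.
have bu := lip_bmeas _ _ _ L0 uM (LipK_norm L u L0 uL).
suff H x y : Ir t u x - Ir t u y <= L * expR (c * t) * `|K (x - y)|.
  move=> x y; rewrite ler_norml H andbT lerNl opprB.
  by have := H y x; rewrite linearB distrC -linearB.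
rewrite lerBlDr -lee_fin -IrE//.
apply: ge_ereal_sup => _ [nu nuP <-].
have bx := bmeas_add u (psi t x) bu.
have by' := bmeas_add u (psi t y) bu.
set D := L * _ * _.
have [cs [cs0 Wcs _ _]] := Wp_spec sepX p p1 _ _ (mu_Pp _ t0) nuP.
have P0 := Phi_ge0 p c phi pen t cs t0.
apply: (@le_trans _ _ (D%:E + (\int[nu]_z (u (psi t y + (z : X)))%:E
   - phit c phi t (fine (Wp p (mu t) nu))))%E).
  rewrite addeA; apply: leeB => //; rewrite !bmeas_EFin// -EFinD lee_fin.
  rewrite -[D in leRHS](Rint_cst nu) -RintD//; last exact: bmeas_cst.
  apply: le_Rint => //; first by apply: bmeasD => //; exact: bmeas_cst.
  move=> z; rewrite -lerBlDr; apply: (le_trans (ler_norm _)).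
  apply: (le_trans (uL _ _)); rewrite opprD addrACA subrr addr0 /D -mulrA ler_wpM2l//.
  by rewrite linearB !psi_K// (le_trans (psi_lip _ _ _ t0))// linearB.
rewrite EFinD leeD2l// -IrE//.
by apply: ereal_sup_ubound; exists nu.
Qed.

End operator.

(** * Two steps against one, for Lipschitz functions *)
Section lipschitz_domination.
Context {R : realType} {X : completeNormedModType R} (sepX : separable X).
Context (K : {linear X -> X}) (K_contr : forall x : X, `|K x| <= `|x|).
Context (p : R) (p1 : 1 < p).
Notation bX := (borel X).
Notation bX2 := (borel X * borel X)%type.
Context (mu : R -> probability bX R) (mu_Pp : forall t : R, 0 <= t -> Pp p (mu t)).
Context (psi : R -> X -> X) (psi_cont : forall t : R, 0 <= t -> continuous (psi t)).
Context (flow : forall (s t : R) (u : X -> R) (x : X), 0 <= s -> 0 <= t -> Cb K u ->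
    (\int[mu (t + s)%R]_y (u (psi (t + s) x + (y : X)))%R%:E =
     \int[mu t]_yt \int[mu s]_ys
        (u (psi s (psi t x + (yt : X)) + (ys : X)))%R%:E)%E).
Context (c : R) (c_ge0 : 0 <= c).
Context (psi_lip : forall (t : R) (x1 x2 : X), 0 <= t ->
    `|psi t x1 - psi t x2| <= expR (c * t) * `|x1 - x2|).
Context (psi_K : forall (t : R) (x : X), 0 <= t -> K (psi t x) = psi t (K x)).
Context (phi : R -> \bar R) (pen : penalisation p phi).

Notation I t u := (penop p c phi psi mu t (EFin \o u)).
Notation Ir := (Ir p mu psi c phi).
Notation Phi := (Phi p c phi).

Lemma LipKb_Cb (u : X -> R) : LipKb K u -> Cb K u.
Proof.
move=> uL; exists (fun=> u) => //; split.
  apply: le_lt_trans uL.2; apply: ge_ereal_sup => _ [n _ <-] //.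
move=> r r0.
have -> : (fun=> supnorm_ball r (fun x => u x - u x)) = (fun=> 0%E) :> (nat -> \bar R).
  apply/funext => n; apply/eqP; rewrite eq_le; apply/andP; split.
    by apply: ge_ereal_sup => _ [x _ <-]; rewrite subrr normr0.
  apply: le_ereal_sup_tmp; exists 0%E => //; exists 0 => /=; first by rewrite normr0.
  by rewrite subrr normr0.
exact: cvg_cst.
Qed.

Section two_steps.
Context (t s : R) (t0 : 0 <= t) (s0 : 0 <= s) (x : X).
Context (L M : R) (u : X -> R) (L0 : 0 <= L) (uM : forall x, `|u x| <= M).
Context (uL : forall x y, `|u x - u y| <= L * `|K (x - y)|).

Let ts0 : 0 <= t + s. Proof. exact: addr_ge0. Qed.
Let a := psi (t + s) x.
Let b := psi t x.
Let bu : bmeas (u : bX -> R).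
Proof. exact: lip_bmeas L0 uM (LipK_norm K K_contr L u L0 uL). Qed.
Let L' := L * expR (c * s).
Let L'0 : 0 <= L'. Proof. by rewrite mulr_ge0 ?expR_ge0. Qed.
Let IL : forall x y, `|Ir s u x - Ir s u y| <= L' * `|x - y|.
Proof.
apply: (LipK_norm K K_contr _ _ L'0).
exact: (Ir_lip sepX K K_contr p p1 mu mu_Pp psi c phi pen psi_lip psi_K s L M u s0 L0 uM uL).
Qed.
Let IM : forall x, `|Ir s u x| <= M.
Proof. by move=> y; exact: Ir_bound. Qed.
Let bI : bmeas (Ir s u : bX -> R). Proof. exact: lip_bmeas L'0 IM IL. Qed.
Let M0 : 0 <= M. Proof. exact: le_trans (uM 0). Qed.

(** By the flow identity the first marginal of [Pi] gives functions of [LipKb] the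
    same integrals as [mu (t + s)]; hence both have the same image under [K], and
    [Pi] can be turned into a coupling of [mu (t + s)]. *)
Lemma two_step_law (Pi : probability bX2 R) (C q e : R) : 0 < e ->
  (forall g : bX -> \bar R, measurable_fun setT g -> (forall x, 0 <= g x)%E ->
    (\int[Pi]_w g w.1 = \int[mu t]_y \int[mu s]_y'
        g (step (psi s) b a (y : X) (y' : X) : bX))%E) ->
  (cost p Pi <= C%:E)%E -> (Phi (t + s) C <= q%:E)%E ->
  \int[Pi]_w u (a + (w.2 : X)) <= Ir (t + s) u x + q + e.
Proof.
move=> e0 Pi1 PiC Phq.
have [m [_ hm]] := pushforward_probability Pi (fst : bX2 -> bX) measurable_fst.
have KD : forall D : set bX, measurable D -> m (K @^-1` D) = mu (t + s) (K @^-1` D).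
  apply: K_law_unique => // v vK v0.
  have [Lv [Mv [Lv0 vM vL]]] := (LipKbE K v).1 vK.
  have bv : bmeas (v : bX -> R) := lip_bmeas _ _ _ Lv0 vM (LipK_norm K K_contr Lv v Lv0 vL).
  have mv : measurable_fun setT (fun y : bX => (v (y : X))%:E).
    by apply/measurable_EFinP; case: bv.
  have v0' (y : bX) : (0 <= (v (y : X))%:E)%E by rewrite lee_fin.
  rewrite (hm _ mv v0') (Pi1 _ mv v0').
  (* The flow identity is applied to the translate of [v] that undoes the shift. *)
  pose v' (y : X) := v (y - a).
  have v'K : LipKb K v'.
    apply/LipKbE; exists Lv, Mv; split=> // [y|y z]; first exact: vM.
    by rewrite (le_trans (vL _ _))// opprB addrA subrK.
  have := flow s t v' x s0 t0 (LipKb_Cb _ v'K); rewrite -/a -/b /v' => <-.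
  by apply: eq_integral => y _; rewrite addrC addKr.
have uaL (y z : X) : `|u (a + y) - u (a + z)| <= L * `|K (y - z)|.
  by rewrite (le_trans (uL _ _))// opprD addrACA subrr add0r.
have [Pi' [h1 h2 h3]] := replace_first_marginal sepX p K K_contr
  (mu (t + s)) m Pi (fun z => u (a + z)) L M e hm KD L0 (fun z => uM _) uaL e0.
apply: (le_trans h3); rewrite lerD2r -lerBlDr -lee_fin -IrE//.
have hC : (cost p Pi' <= C%:E)%E by rewrite h2.
exact: (penop_ge sepX p p1 mu mu_Pp psi c phi pen (t + s) C q u x Pi' ts0 bu h1 hC Phq).
Qed.

(** One coupling per cell of a fine countable partition, nearly optimal at the centre
    of the cell. It stays so on the whole cell since both sides of the inequality are
    Lipschitz in the starting point. *)
Lemma near_optimal_selection (e : R) : 0 < e ->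
  exists (n : X -> nat) (Q : nat -> probability bX2 R) (B q : nat -> R),
  [/\ forall i, measurable (n @^-1` [set i] : set bX),
      forall i, image_law (Q i) fst (mu s),
      forall i, 0 <= B i /\ (cost p (Q i) <= (B i)%:E)%E,
      forall i, 0 <= q i /\ (Phi s (B i) <= (q i)%:E)%E &
      forall y, Ir s u y <= \int[Q (n y)]_w u (psi s y + (w.2 : X)) - q (n y) + e].
Proof.
move=> e0.
have L'1 : 0 < L' + 1 by rewrite ltr_wpDl.
pose delta := e / 4 / (L' + 1).
have d0 : 0 < delta by rewrite !divr_gt0.
have [d [n [mn nd]]] := borel_cells sepX delta d0.
have e2 : 0 < e / 2 by rewrite divr_gt0.
have unL := LipK_norm K K_contr L u L0 uL.
have : forall i, exists z : probability bX2 R * R * R,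
   [/\ image_law z.1.1 fst (mu s), (0 <= z.1.2) /\ (cost p z.1.1 <= z.1.2%:E)%E,
       0 <= z.2 /\ (Phi s z.1.2 <= z.2%:E)%E &
       Ir s u (d i) <= \int[z.1.1]_w u (psi s (d i) + (w.2 : X)) - z.2 + e / 2].
  move=> i.
  have [pi [C [q [h1 h2 h3 h4]]]] := near_optimal sepX p p1 mu mu_Pp psi c phi pen
     s L M (e / 2) u (d i) s0 L0 uM unL e2.
  by exists (pi, C, q).
move=> /choice[z hz].
exists n, (fun i => (z i).1.1), (fun i => (z i).1.2), (fun i => (z i).2).
split=> // [i|i|i|y]; try by have [] := hz i.
have [_ _ _ Hd] := hz (n y); set i := n y in Hd *.
have dy : `|y - d i| <= delta by exact/ltW/nd.
have Ld : L' * `|y - d i| <= e / 4.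
  apply: (le_trans (ler_wpM2l L'0 dy)).
  rewrite /delta mulrCA -[leRHS]mulr1 ler_wpM2l ?divr_ge0 ?(ltW e0)//.
  by rewrite ler_pdivrMr// mul1r lerDl.
have H1 : Ir s u y <= Ir s u (d i) + e / 4.
  by rewrite -lerBlDl (le_trans (ler_norm _))// (le_trans (IL _ _)).
have H2 : \int[(z i).1.1]_w u (psi s (d i) + (w.2 : X)) <=
          \int[(z i).1.1]_w u (psi s y + (w.2 : X)) + e / 4.
  rewrite -[e / 4 in leRHS](Rint_cst (z i).1.1) -RintD//; first last.
  - exact: bmeas_cst.
  - exact: bmeas_add_snd.
  apply: le_Rint => //; first exact: bmeas_add_snd.
    by apply: bmeasD; [exact: bmeas_add_snd|exact: bmeas_cst].
  move=> w; rewrite -lerBlDl (le_trans (ler_norm _))//.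
  apply: le_trans Ld; rewrite distrC; apply: (le_trans (unL _ _)).
  rewrite /L' -mulrA ler_wpM2l// opprD addrACA subrr addr0.
  exact: psi_lip.
move: Hd H1 H2; set A1 := Rintegral _ _ _; set A2 := Rintegral _ _ _; lra.
Qed.

(** Paste [Pi0] with the couplings of [near_optimal_selection], chosen by the cell of
    the point reached by the second component. All but finitely many cells receive
    the diagonal coupling, whose cost is zero; they are visited rarely and lose at most
    [2 * M] each time. *)
Lemma two_step_bound (A q0 : R) (Pi0 : probability bX2 R) (e : R) : 0 < e ->
  image_law Pi0 fst (mu t) -> 0 <= A -> (cost p Pi0 <= A%:E)%E ->
  (Phi t A <= q0%:E)%E ->
  \int[Pi0]_w Ir s u (b + (w.2 : X)) - q0 <= Ir (t + s) u x + e.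
Proof.
move=> e0 h01 A0 hA hq0.
have e3 : 0 < e / 3 by rewrite divr_gt0.
have [n [Q0 [B0 [q1 [mn Q0m hB hq hI]]]]] := near_optimal_selection _ e3.
pose n' (w : bX2) := n (b + (w.2 : X)).
have mn' : forall i, measurable (n' @^-1` [set i]).
  by move=> i; exact: measurable_cell.
have M1 : 0 < 2 * M + 1 by rewrite ltr_wpDl// mulr_ge0.
have [N hN] := tail_small Pi0 n' mn' _ (divr_gt0 e3 M1).
have [D [D1 _ D2]] := diag_coupling sepX p p1 (mu s).
pose Q i := if (i < N)%N then Q0 i else D.
pose B i := if (i < N)%N then B0 i else 0.
pose q i := if (i < N)%N then q1 i else 0.
have Qm i : image_law (Q i) fst (mu s) by rewrite /Q; case: ifP.
have Bge i : 0 <= B i by rewrite /B; case: ifP => // _; have [] := hB i.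
have BN i : (N <= i)%N -> B i = 0 by rewrite /B ltnNge => ->.
have cB i : (cost p (Q i) <= (B i)%:E)%E.
  by rewrite /Q /B; case: ifP => _; [have [] := hB i|rewrite D2].
have qge i : 0 <= q i by rewrite /q; case: ifP => // _; have [] := hq i.
have qN i : (N <= i)%N -> q i = 0 by rewrite /q ltnNge => ->.
have k0 : 0 <= expR (c * s) by exact: expR_ge0.
have mstep := measurable_step2 sepX (psi s) (psi_cont s s0) b a.
have [Pi hPi] := mixture Pi0 n' Q _ mn' mstep.
have [bG PiE] := concat_snd sepX (psi s) (psi_cont s s0) b a Pi0 n Q Pi hPi u bu.
pose Bs := \sum_(0 <= i < N) mass Pi0 n' i * B i.
pose Qs := \sum_(0 <= i < N) mass Pi0 n' i * q i.
have Bs0 : 0 <= Bs by apply: sumr_ge0 => i _; rewrite mulr_ge0// mass_ge0.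
have cPi r : 0 < r < 1 -> (cost p Pi <= (r * (r^-1 * expR (c * s)) `^ p * A +
     (1 - r) * ((1 - r)^-1) `^ p * Bs)%:E)%E.
  exact: (concat_cost sepX p p1 (psi s) _ k0 (psi_cont s s0) (fun y z => psi_lip s y z s0)
     b a Pi0 n Q mn Pi hPi N A B Bge BN hA cB r).
have [C [C0 CE]] : exists C, 0 <= C /\ cost p Pi = C%:E.
  have := cPi 2^-1 ltac:(lra); have := cost_ge0 p Pi.
  case: (cost p Pi) => [r| |]; rewrite ?leye_eq//.
  by rewrite lee_fin => r0 _; exists r.
have PhB : (Phi s Bs <= Qs%:E)%E.
  apply: (Phi_jensen p c phi p1 pen s N (mass Pi0 n') B q s0); last exact: mass_le1.
  move=> i iN; split=> //; first exact: mass_ge0.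
  by rewrite /B /q iN; have [] := hq i.
have PhC : (Phi (t + s) C <= (q0 + Qs)%:E)%E.
  apply: (Phi_add p c phi p1 c_ge0 pen t s A Bs C q0 Qs t0 s0 A0 Bs0 C0) => // r r01.
  by rewrite -lee_fin -CE; exact: cPi.
have law g : measurable_fun setT g -> (forall x, 0 <= g x)%E ->
    (\int[Pi]_w g w.1 = \int[mu t]_y \int[mu s]_y'
        g (step (psi s) b a (y : X) (y' : X) : bX))%E.
  exact: (concat_fst sepX (psi s) (psi_cont s s0) (mu s) b a Pi0 n Q Qm Pi hPi (mu t) g h01).
have cPi' : (cost p Pi <= C%:E)%E by rewrite CE.
have := two_step_law Pi C (q0 + Qs) _ e3 law cPi' PhC.
rewrite PiE => H.
have bIr : bmeas (fun w : bX2 => Ir s u (b + (w.2 : X))) by exact: bmeas_add_snd.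
have mq : measurable_fun setT (fun w => q (n' w)) by exact: measurable_comp_nat.
have bq : bmeas (fun w : bX2 => q (n' w)).
  split=> //; exists (\sum_(0 <= i < N) q i) => w; rewrite ger0_norm//.
  have [nN|Nn] := ltnP (n' w) N; last by rewrite qN// sumr_ge0.
  by rewrite (bigD1_seq (n' w)) ?iota_uniq ?mem_index_iota//= lerDl sumr_ge0.
have QsE : \int[Pi0]_w q (n' w) = Qs.
  by apply: EFin_inj; rewrite -bmeas_EFin// (integral_comp_nat Pi0 n' mn' N q).
pose T := [set w : bX2 | (N <= n' w)%N].
have mT : measurable T by exact: measurable_tail.
have H2 : \int[Pi0]_w (Ir s u (b + (w.2 : X)) + q (n' w)) <=
  \int[Pi0]_w \int[Q (n' w)]_w' u (psi s (b + (w.2 : X)) + (w'.2 : X)) + (e / 3 + e / 3).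
  apply: (Rint_le_add _ _ _ (fun w => 2 * M * \1_T w)).
  - exact: bmeasD.
  - exact: bG.
  - by apply: measurable_funM => //; exact: measurable_indic.
  - by move=> w; rewrite !mulr_ge0.
  - under eq_integral do rewrite EFinM.
    have mI : measurable_fun setT (fun y : bX2 => (\1_T y : R)%:E).
      by apply/measurable_EFinP; exact: measurable_indic.
    have I0 (y : bX2) : setT y -> (0 <= (\1_T y : R)%:E)%E by move=> _; rewrite lee_fin.
    have M20 : 0 <= 2 * M by rewrite mulr_ge0.
    rewrite ge0_integralZl_EFin// integral_indic// setIT.
    have M20e : (0 <= (2 * M)%:E)%E by rewrite lee_fin.
    apply: (le_trans (lee_wpmul2l M20e hN)); rewrite -EFinM lee_fin.
    rewrite mulrCA -[leRHS]mulr1 ler_wpM2l ?(ltW e3)// ler_pdivrMr// mul1r.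
    by rewrite lerDl.
  - move=> w; set y := b + _.
    have [nN|Nn] := ltnP (n' w) N.
      rewrite indicE memNset ?mulr0 ?addr0; last by rewrite /T /= leqNgt nN.
      by have := hI y; rewrite -/(n' w) /Q /q nN; lra.
    rewrite indicE mem_set//= mulr1 qN// addr0.
    have bnd : `|\int[Q (n' w)]_w' u (psi s y + (w'.2 : X))| <= M.
      by apply: Rint_bound => //; exact: bmeas_add_snd.
    move: bnd (IM y); rewrite !ler_norml => /andP[g1 g2] /andP[g3 g4]; lra.
move: H2; rewrite RintD// QsE => H2.
move: H H2; rewrite -/n'; set A1 := Rintegral _ _ _; set A2 := Rintegral _ _ _; lra.
Qed.

Lemma penop_comp_le_lip : (I t (Ir s u) x <= I (t + s) u x)%E.
Proof.
apply: ge_ereal_sup => _ [nu nuP <-].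
rewrite (IrE sepX p p1 mu mu_Pp psi c phi pen (t + s))//.
set v := (_ - _)%E.
have [->|vN] := eqVneq v -oo%E; first by rewrite leNye.
have [r vr] : exists r, v = r%:E.
  move: vN; rewrite /v /=.
  have [cs [cs0 Wcs _ _]] := Wp_spec sepX p p1 _ _ (mu_Pp _ t0) nuP.
  rewrite Wcs -/(Phi t cs) bmeas_EFin; last exact: bmeas_add.
  have := Phi_ge0 p c phi pen t cs t0.
  by case: (Phi t cs) => [q| |]//= _ _; eexists.
rewrite vr lee_fin; apply/ler_addgt0Pr => e e0.
have e2 : 0 < e / 2 by rewrite divr_gt0.
have vv : (r%:E <= v)%E by rewrite vr.
have [pi [A [q [h1 [A0 hA] [q0 hq] h4]]]] := near_coupling sepX p p1 mu mu_Pp psi c phi pen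
  t L' M _ r (Ir s u) x nu t0 L'0 IM IL e2 nuP vv.
have := two_step_bound A q pi (e / 2) e2 h1 A0 hA hq.
rewrite -/b in h4 *; lra.
Qed.

End two_steps.
End lipschitz_domination.

(** * Continuity of the operator for the mixed topology *)
Section tightness.
Context {R : realType} {X : completeNormedModType R} (sepX : separable X).
Context (p : R) (p1 : 1 < p).
Notation bX := (borel X).
Notation bX2 := (borel X * borel X)%type.
Context (mu : R -> probability bX R) (mu_Pp : forall t : R, 0 <= t -> Pp p (mu t)).
Context (psi : R -> X -> X) (c : R) (phi : R -> \bar R) (pen : penalisation p phi).

Notation I t u := (penop p c phi psi mu t (EFin \o u)).
Notation Ir := (Ir p mu psi c phi).
Notation Phi := (Phi p c phi).

Lemma bounded_cvg (T : Type) (f_ : nat -> T -> R) (f : T -> R) (M : R) :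
  (forall n x, `|f_ n x| <= M) -> (forall x, f_ n x @[n --> \oo] --> f x) ->
  forall x, `|f x| <= M.
Proof.
move=> fM fc x; apply/ler_addgt0Pr => e e0.
have /cvgrPdist_le/(_ e e0)[n _ H] := fc x; have := H n (leqnn _) => /= {}H.
by rewrite -(subrK (f_ n x) (f x)) addrC (le_trans (ler_normD _ _))// lerD.
Qed.

Lemma bmeas_cvg d (T : measurableType d) (f_ : nat -> T -> R) (f : T -> R) (M : R) :
  (forall n, measurable_fun setT (f_ n)) -> (forall n x, `|f_ n x| <= M) ->
  (forall x, f_ n x @[n --> \oo] --> f x) -> bmeas f.
Proof.
move=> mf fM fc; split; first by apply: (measurable_fun_cvg mf) => x _; exact: fc.
by exists M; exact: bounded_cvg fM fc.
Qed.

Lemma Rint_cvg d (T : measurableType d) (P : probability T R)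
    (f_ : nat -> T -> R) (f : T -> R) (M : R) :
  (forall n, measurable_fun setT (f_ n)) -> (forall n x, `|f_ n x| <= M) ->
  (forall x, f_ n x @[n --> \oo] --> f x) ->
  \int[P]_x f_ n x @[n --> \oo] --> \int[P]_x f x.
Proof.
move=> mf fM fc.
have bn n : bmeas (f_ n) by split=> //; exists M.
have bf : bmeas f by exact: bmeas_cvg mf fM fc.
have D : (\int[P]_x (f_ n x)%:E)%E @[n --> \oo] --> (\int[P]_x (f x)%:E)%E.
  apply: (@dominated_cvg _ T R P setT measurableT _ _ (fun _ => M%:E)) => //.
  - by move=> n; exact/measurable_EFinP.
  - by move=> x _; apply: cvg_EFin; [exact: nearW|exact: fc].
  - exact: finite_measure_integrable_cst.
  - by move=> n x _; rewrite lee_fin.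
by rewrite (bmeas_EFin P f bf) in D; exact: fine_cvg D.
Qed.

(** Competitors with penalty above [2 * M] are no better than the diagonal coupling. The
    others have bounded transport cost by coercivity, hence [p]-th moments bounded
    uniformly, so they put little mass outside a large ball. *)
Lemma penop_tight (t M e : R) (x : X) : 0 <= t -> 0 <= M -> 0 < e ->
  exists r, 0 <= r /\ forall u1 u2 : X -> R,
    bmeas (u1 : bX -> R) -> bmeas (u2 : bX -> R) ->
    (forall y, `|u1 y| <= M) -> (forall y, `|u2 y| <= M) ->
    (forall y, `|y| <= r -> `|u1 y - u2 y| <= e) ->
    Ir t u1 x <= Ir t u2 x + (e + e).
Proof.
move=> t0 M0 e0.
have [D HD] := phit_coercive p c phi pen t (2 * M) t0.
have p0 : 0 < p by exact: lt_trans ltr01 p1.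
have mt := mu_Pp t t0.
pose m := fine (moment p (mu t)).
have m0 : (0 <= moment p (mu t))%E by apply: integral_ge0 => y _; rewrite lee_fin powR_ge0.
have mm : (moment p (mu t) <= m%:E)%E by rewrite fineK// ge0_fin_numE.
pose H := 2 `^ p * (m + (D `^ p + 1)).
have H0 : 0 <= H by rewrite mulr_ge0 ?powR_ge0// !addr_ge0 ?powR_ge0// fine_ge0.
have MH : 0 < 2 * M * H + 1.
  by apply: ltr_wpDl => //; apply: mulr_ge0 => //; exact: mulr_ge0.
(* Chosen so that the Markov bound [2 * M * (H / r' `^ p)] is below [e]. *)
pose r' := ((2 * M * H + 1) / e) `^ p^-1.
have r'p : r' `^ p = (2 * M * H + 1) / e.
  by rewrite /r' -powRrM mulVf ?gt_eqF// powRr1// divr_ge0 ?ltW.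
have r'0 : 0 <= r' by exact: powR_ge0.
have r'p0 : 0 < r' `^ p by rewrite r'p divr_gt0.
exists (`|psi t x| + r'); split; first by rewrite addr_ge0.
move=> u1 u2 b1 b2 u1M u2M u12.
rewrite -lee_fin EFinD -!(IrE sepX p p1 mu mu_Pp psi c phi pen)//.
apply: ge_ereal_sup => _ [nu nuP <-].
have [cs [cs0 Wcs app _]] := Wp_spec sepX p p1 _ _ mt nuP.
rewrite Wcs -/(Phi t cs).
have b1' : bmeas (fun z : bX => u1 (psi t x + (z : X))) by exact: bmeas_add.
have b2' : bmeas (fun z : bX => u2 (psi t x + (z : X))) by exact: bmeas_add.
have P0 := Phi_ge0 p c phi pen t cs t0.
rewrite bmeas_EFin//=.
have [Plarge|Psmall] := leP (2 * M)%:E (Phi t cs); last first.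
  have csD : cs <= D `^ p.
    have D1 : cs `^ p^-1 <= D by apply: HD; [exact: powR_ge0|exact: ltW].
    have D0 : 0 <= D by apply: le_trans D1; exact: powR_ge0.
    have <- : (cs `^ p^-1) `^ p = cs by rewrite -powRrM mulVf ?gt_eqF// powRr1.
    by rewrite ge0_ler_powR ?nnegrE ?powR_ge0// ltW.
  have [pi [h1 h2 h3]] := app 1 ltr01.
  have h3' : (cost p pi <= (D `^ p + 1)%:E)%E by rewrite (le_trans h3)// lee_fin lerD2r.
  have mnu : (moment p nu <= H%:E)%E := moment_le_cost sepX p p1 _ _ _ _ _ h1 h2 mm h3'.
  apply: (@le_trans _ _ (((\int[nu]_z u2 (psi t x + (z : X)) + (e + e))%:E - Phi t cs)%E)).
    apply: leeB => //; rewrite lee_fin.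
    have mn : measurable_fun setT (fun z : bX => `|z : X|) by exact: measurable_normX.
    apply: (Rint_le_add _ _ _ (fun z : bX => 2 * M / r' `^ p * `|z : X| `^ p)) => //.
    - exact: (@measurable_Zpow _ _ R p _ (fun z : bX => `|z : X|)).
    - by move=> z; rewrite !mulr_ge0 ?invr_ge0 ?powR_ge0.
    - have k0 : 0 <= 2 * M / r' `^ p by rewrite !mulr_ge0 ?invr_ge0 ?powR_ge0.
      have k0e : (0 <= (2 * M / r' `^ p)%:E)%E by rewrite lee_fin.
      rewrite (@integral_powRZl _ _ _ nu p _ (fun z : bX => `|z : X|))//.
      apply: (le_trans (lee_wpmul2l k0e mnu)); rewrite -EFinM lee_fin r'p invf_div.
      have -> : 2 * M * (e / (2 * M * H + 1)) * H = (2 * M * H * e) / (2 * M * H + 1) by ring.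
      by rewrite ler_pdivrMr// mulrDr mulr1 [e * _]mulrC lerDl ltW.
    - move=> z; rewrite -lerBlDl; apply: (le_trans (ler_norm _)).
      have [zr|zr] := leP `|z : X| r'.
        have /u12 : `|psi t x + (z : X)| <= `|psi t x| + r'.
          by rewrite (le_trans (ler_normD _ _))// lerD2l.
        move=> /le_trans; apply; rewrite lerDl !mulr_ge0 ?invr_ge0 ?powR_ge0//.
      have z1 : 1 <= `|z : X| `^ p / r' `^ p.
        rewrite ler_pdivlMr// mul1r ge0_ler_powR ?nnegrE ?(ltW p0)//; exact: ltW.
      rewrite (le_trans (ler_normB _ _))//.
      have -> : 2 * M / r' `^ p * `|z : X| `^ p = 2 * M * (`|z : X| `^ p / r' `^ p) by ring.
      have h : 2 * M <= 2 * M * (`|z : X| `^ p / r' `^ p).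
        by rewrite ler_peMr// mulr_ge0.
      have := u1M (psi t x + (z : X)); have := u2M (psi t x + (z : X)); lra.
  rewrite EFinD addeAC leeD2r//; apply: ereal_sup_ubound; exists nu => //.
  by rewrite Wcs -/(Phi t cs) bmeas_EFin.
have u1I : \int[nu]_z u1 (psi t x + (z : X)) <= M.
  by apply: (le_trans (ler_norm _)); exact: Rint_bound.
have I2 : - M <= Ir t u2 x.
  have := Ir_bound sepX p p1 mu mu_Pp psi c phi pen t M u2 x t0 b2 u2M.
  by rewrite ler_norml => /andP[].
rewrite (IrE sepX p p1 mu mu_Pp psi c phi pen)// -EFinD.
apply: (@le_trans _ _ (M - 2 * M)%:E).
  by rewrite EFinB; apply: leeB => //; rewrite lee_fin.
by rewrite lee_fin; lra.
Qed.

End tightness.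

(** * Mixed convergence *)
Section mixed.
Context {R : realType} {X : completeNormedModType R}.

Lemma mixed_cvg_bound (u_ : nat -> X -> R) (u : X -> R) : mixed_cvg u_ u ->
  exists M, forall n x, `|u_ n x| <= M.
Proof.
move=> [ub _].
have ge0 : (0 <= ereal_sup (range (fun n => supnorm (u_ n))))%E.
  apply: le_ereal_sup_tmp; exists (supnorm (u_ 0%N)); first by exists 0%N.
  by apply: le_ereal_sup_tmp; exists `|u_ 0%N 0|%:E; [exists 0|rewrite lee_fin].
exists (fine (ereal_sup (range (fun n => supnorm (u_ n))))) => n x.
rewrite -lee_fin fineK ?ge0_fin_numE//.
apply: (@le_trans _ _ (supnorm (u_ n))); last by apply: ereal_sup_ubound; exists n.
by apply: ereal_sup_ubound; exists x.
Qed.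

Lemma mixed_cvg_unif (u_ : nat -> X -> R) (u : X -> R) (r e : R) : mixed_cvg u_ u ->
  0 <= r -> 0 < e -> exists n0, forall n, (n0 <= n)%N ->
  forall y, `|y| <= r -> `|u y - u_ n y| <= e.
Proof.
move=> [_ H] r0 e0; have /fine_cvgP[[n1 _ H1] H2] := H r r0.
have [n2 _ H3] := cvgr_lt _ H2 _ e0.
exists (maxn n1 n2) => n; rewrite geq_max => /andP[h1 h2] y yr.
have := H3 n h2; rewrite /= => /ltW; rewrite -lee_fin fineK; last exact: H1.
by move=> h; rewrite -lee_fin (le_trans _ h)//; apply: ereal_sup_ubound; exists y.
Qed.

End mixed.

(** * Two steps against one *)
Theorem lemma3p10 (R : realType) (X : completeNormedModType R)
  (X_separable : separable X)
  (K : {linear X -> X})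
  (K_compact : forall r : R, 0 <= r ->
    compact [set K x | x in [set x : X | `|x| <= r]])
  (K_dense : dense (range K))
  (K_contr : forall x : X, `|K x| <= `|x|)
  (p : R) (p_gt1 : 1 < p)
  (mu : R -> probability (borel X) R)
  (mu_Pp : forall t : R, 0 <= t -> Pp p (mu t))
  (psi : R -> X -> X)
  (psi_cont : forall t : R, 0 <= t -> continuous (psi t))
  (flow : forall (s t : R) (u : X -> R) (x : X), 0 <= s -> 0 <= t -> Cb K u ->
    (\int[mu (t + s)%R]_y (u (psi (t + s) x + (y : X)))%R%:E =
     \int[mu t]_yt \int[mu s]_ys
        (u (psi s (psi t x + (yt : X)) + (ys : X)))%R%:E)%E)
  (c : R) (c_ge0 : 0 <= c)
  (psi_lip : forall (t : R) (x1 x2 : X), 0 <= t ->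
    `|psi t x1 - psi t x2| <= expR (c * t) * `|x1 - x2|)
  (psi_K : forall (t : R) (x : X), 0 <= t -> K (psi t x) = psi t (K x))
  (psi_0 : forall x : X, psi 0 x = x)
  (psi_cvg : forall r : R, 0 <= r ->
    ereal_sup [set `|psi h (K x) - K x|%:E | x in [set x : X | `|x| <= r]]
      @[h --> 0^'+] --> 0%E)
  (mu_cvg : moment p (mu h) @[h --> 0^'+] --> 0%E)
  (phi : R -> \bar R) (phi_pen : penalisation p phi)
  (s t : R) (s_ge0 : 0 <= s) (t_ge0 : 0 <= t)
  (u : X -> R) (u_Cb : Cb K u) (x : X) :
  (penop p c phi psi mu t (penop p c phi psi mu s (EFin \o u)) x
     <= penop p c phi psi mu (t + s)%R (EFin \o u) x)%E.

Proof.
have [u_ uL cv] := u_Cb.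
have [M uM] := mixed_cvg_bound u_ u cv.
have M0 : 0 <= M by exact: le_trans (uM 0%N 0).
have fc y : u_ n y @[n --> \oo] --> u y.
  apply/cvgrPdist_le => e e0.
  have [n0 H] := mixed_cvg_unif u_ u `|y| e cv (normr_ge0 _) e0.
  by exists n0 => // n /= n0n; exact: H.
have bn n : bmeas (u_ n : borel X -> R).
  have [L [N [L0 uN uLn]]] := (LipKbE K (u_ n)).1 (uL n).
  exact: lip_bmeas L0 uN (LipK_norm K K_contr L _ L0 uLn).
have bu : bmeas (u : borel X -> R) := bmeas_cvg _ _ _ _ _ (fun n => (bn n).1) uM fc.
have uM' y : `|u y| <= M := bounded_cvg _ _ _ _ uM fc y.
have Ic r y : 0 <= r ->
    Ir p mu psi c phi r (u_ n) y @[n --> \oo] --> Ir p mu psi c phi r u y.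
  move=> r0; apply/cvgrPdist_le => e e0; have e2 : 0 < e / 2 by rewrite divr_gt0.
  have [rad [rad0 H]] := penop_tight X_separable p p_gt1 mu mu_Pp psi c phi phi_pen
    r M _ y r0 M0 e2.
  have [n0 H0] := mixed_cvg_unif u_ u rad _ cv rad0 e2.
  exists n0 => // n /= n0n; have {}H0 := H0 n n0n.
  have H1 := H u (u_ n) bu (bn n) uM' (uM n) H0.
  have H2 := H (u_ n) u (bn n) bu (uM n) uM' _.
  rewrite -splitr in H1 H2; rewrite ler_norml lerBlDl H1 andbT lerNl opprB lerBlDl.
  by apply: H2 => z zr; rewrite distrC; exact: H0.
pose f n y := Ir p mu psi c phi s (u_ n) y; pose g y := Ir p mu psi c phi s u y.
have fM n y : `|f n y| <= M.
  exact: (Ir_bound X_separable p p_gt1 mu mu_Pp psi c phi phi_pen).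
have fc' y : f n y @[n --> \oo] --> g y by exact: Ic.
have bf n : bmeas (f n : borel X -> R).
  have [L [N [L0 uN uLn]]] := (LipKbE K (u_ n)).1 (uL n).
  have IL := Ir_lip X_separable K K_contr p p_gt1 mu mu_Pp psi c phi phi_pen
     psi_lip psi_K s L N _ s_ge0 L0 uN uLn.
  have LE : 0 <= L * expR (c * s) by rewrite mulr_ge0 ?expR_ge0.
  exact: lip_bmeas LE (fM n) (LipK_norm K K_contr _ _ LE IL).
have bg : bmeas (g : borel X -> R) := bmeas_cvg _ _ _ _ _ (fun n => (bf n).1) fM fc'.
have -> : penop p c phi psi mu s (EFin \o u) = EFin \o g.
  by apply/funext => y; rewrite (IrE X_separable p p_gt1 mu mu_Pp psi c phi phi_pen).
have ts0 : 0 <= t + s by rewrite addr_ge0.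
rewrite (IrE X_separable p p_gt1 mu mu_Pp psi c phi phi_pen (t + s))//.
apply: ge_ereal_sup => _ [nu nuP <-] /=.
have bga := bmeas_add X_separable g (psi t x) bg.
rewrite bmeas_EFin//; set Pt := phit _ _ _ _.
have [[q Pq]|Pq] : (exists q, Pt = q%:E) \/ Pt = +oo%E; last by rewrite Pq leNye.
  have : (0 <= Pt)%E.
    by apply: (phit_ge0 p c phi phi_pen) => //; exact: fine_ge0 (poweR_ge0 _ _).
  by case: Pt => [q| |]// _; [left; exists q|right].
rewrite Pq -EFinB lee_fin.
have := Rint_cvg _ _ nu (fun n (z : borel X) => f n (psi t x + (z : X)))
  (fun z : borel X => g (psi t x + (z : X))) M
  (fun n => (bmeas_add X_separable (f n) (psi t x) (bf n)).1) (fun n z => fM n _) (fun z => fc' _).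
move=> Icv; (* Each competitor against [I s u] is a limit of competitors against [I s (u_ n)],
   where the inequality for Lipschitz functions applies. *)
apply: (ler_cvg_to (cvgB Icv (cvg_cst q)) (Ic _ x ts0)).
apply: nearW => n.
have [L [N [L0 uN uLn]]] := (LipKbE K (u_ n)).1 (uL n).
have := penop_comp_le_lip X_separable K K_contr p p_gt1 mu mu_Pp psi psi_cont flow
  c c_ge0 psi_lip psi_K phi phi_pen t s t_ge0 s_ge0 x L N (u_ n) L0 uN uLn.
rewrite (IrE X_separable p p_gt1 mu mu_Pp psi c phi phi_pen (t + s))// -lee_fin.
apply: le_trans; apply: ereal_sup_ubound; exists nu => //=.
by rewrite (bmeas_EFin nu _ (bmeas_add X_separable (f n) (psi t x) (bf n))) -/Pt Pq.
Qed.
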